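(* Let $f$ be an operator monotone function on $(0,\infty)$ such that $f(1)=0$ and $f'(1)=1$. Let $Y_1,Y_2,\ldots$ be a sequence of i.i.d. $\mathbb{P}$-valued random variables with law $\mu$ on $\mathbb{P}$ such that $$\int_{\mathbb{P}}\|f(y)\|\log^{+}\|f(y)\|\,d\mu(y)<\infty.$$ Then for any initial $S_1\in\mathbb{P}$, the stochastic resolvent iteration $$S_{n+1}=J_{\frac{1}{n+1}}(Y_{n+1},S_n),\qquad n\ge1,$$ is almost surely bounded in the Thompson metric $d_\infty$.
   Context: $\mathcal{H}$ is a Hilbert space and $\mathbb{P}$ is the cone of positive definite invertible bounded operators on $\mathcal{H}$, equipped with the Thompson metric $d_\infty(a,b)=\|\log(a^{-1/2}ba^{-1/2})\|$, $\|\cdot\|$ being the operator norm. Borel probability measures $\mu$ on $\mathbb{P}$ are assumed fully supported, i.e. $\mu(\operatorname{supp}\mu)=1$ (the support is then separable). $\log^+ t=\max\{\log t,0\}$, with $0\log^+0=0$. For $x,y\in\mathbb{P}$ put $f_x(y)=x^{1/2}f(x^{-1/2}yx^{-1/2})x^{1/2}$ and $\log_x y=x^{1/2}\log(x^{-1/2}yx^{-1/2})x^{1/2}$. For $\lambda>0$ and $y,z\in\mathbb{P}$, $J_\lambda(y,z)$ is the unique solution $x\in\mathbb{P}$ of $\lambda f_x(y)+\log_x z=0$. Boundedness in $d_\infty$ means $\sup_n d_\infty(S_n,I)<\infty$, equivalently there is a (random) $c>0$ with $c^{-1}I\le S_n\le cI$ for all $n$. *)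

(* Defs.v *)
From HB Require Import structures.
From mathcomp Require Import all_boot all_order all_algebra.
From mathcomp Require Import finmap.
From mathcomp Require Import complex sesquilinear.
From mathcomp Require Import all_classical all_reals all_analysis.

Set Implicit Arguments.
Unset Strict Implicit.
Unset Printing Implicit Defensive.

Import Order.TTheory GRing.Theory Num.Theory.
Import numFieldNormedType.Exports.

Local Open Scope classical_set_scope.
Local Open Scope complex_scope.
Local Open Scope ring_scope.

(** Complex Hilbert spaces; the inner product is linear in its first argument
    and conjugate-linear in its second. *)
Record hilbertType (R : realType) := Hilbert {
  hspace :> completeNormedModType R[i] ;
  hdot : {dot hspace for Num.conj} ;
  hdot_norm : forall x : hspace, `|x| ^+ 2 = hdot x x }.

Section Operators.
Variables (R : realType) (H : hilbertType R).
Implicit Types (a b : H -> H) (f : R -> R).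

Definition bounded_op a :=
  linear a /\ exists M : R, forall x, `|a x| <= M%:C * `|x|.

(* Norms of vectors are elements of R[i] that happen to be real. *)
Definition opnorm a : R :=
  sup [set complex.Re `|a x| | x in [set x : H | `|x| <= 1]].

Definition invertible_op a :=
  exists b, [/\ bounded_op b, b \o a = id & a \o b = id].

Definition selfadjoint a :=
  forall x y, hdot H (a x) y = hdot H x (a y).

Definition op_le a b := forall x, hdot H (a x) x <= hdot H (b x) x.

(* Only real spectral values: the calculus below is applied to self-adjoint
   operators, whose whole spectrum is real. *)
Definition real_spectrum a : set R :=
  [set t | ~ invertible_op (fun x => a x - t%:C *: x)].

Definition poly_op (p : {poly R}) a : H -> H :=
  fun x => \sum_(i < size p) (p`_i)%:C *: iter i a x.

(** The continuous functional calculus of a self-adjoint operator: [f(a)] is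
    the limit in operator norm of [p_n(a)] for any polynomials [p_n] that
    converge to [f] uniformly on the spectrum of [a]. *)
Definition is_fcalc f a b :=
  bounded_op b /\
  forall e : R, 0 < e -> exists p : {poly R},
    (forall t, real_spectrum a t -> `|f t - p.[t]| <= e) /\
    opnorm (b - poly_op p a) <= e.

(* [is_fcalc f a] has exactly one element when [a] is self-adjoint and [f] is
   continuous on its spectrum; the default value 0 is then irrelevant. *)
Definition fcalc f a : H -> H := xget 0 [set b | is_fcalc f a b].

Definition posdef a :=
  [/\ bounded_op a, selfadjoint a,
      forall x, x != 0 -> 0 < hdot H (a x) x & invertible_op a].

Record posop := PosOp { posop_val :> H -> H ; posopP : posdef posop_val }.

Lemma posdef_id : posdef id.
Proof.
have bid : bounded_op id.
  by split=> //; exists 1 => x; rewrite mul1r.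
split=> //; last by exists id.
by move=> x x0; exact: neq0_dnorm_gt0.
Qed.

Definition posop1 : posop := PosOp posdef_id.

HB.instance Definition _ := gen_eqMixin posop.
HB.instance Definition _ := gen_choiceMixin posop.
HB.instance Definition _ := isPointed.Build posop posop1.

Implicit Types x y z : posop.

Definition psqrt x : H -> H := fcalc Num.sqrt x.

Definition pisqrt x : H -> H := fcalc (fun t => (Num.sqrt t)^-1) x.

(** [f_x(y) = x^{1/2} f(x^{-1/2} y x^{-1/2}) x^{1/2}]; [log_x y] is
    [fat ln x y]. *)
Definition fat f x y : H -> H :=
  psqrt x \o fcalc f (pisqrt x \o y \o pisqrt x) \o psqrt x.

Definition thompson x y : R :=
  opnorm (fcalc (@ln R) (pisqrt x \o y \o pisqrt x)).

Definition thompson_open : set (set posop) :=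
  [set A | forall x, A x ->
     exists2 e : R, 0 < e & forall y, thompson x y < e -> A y].

Definition is_resolvent f (lambda : R) y z x :=
  lambda%:C *: fat f x y + fat (@ln R) x z = 0.

(** [J_lambda(y, z)] is the unique solution of the resolvent equation. Since a
    solution exists for every [lambda > 0], the default value [z] is never
    returned in that range. *)
Definition resolvent f (lambda : R) y z : posop :=
  xget z [set x | is_resolvent f lambda y z x].

(** Indices are shifted by one: [ys k] stands for [Y_{k+1}] and
    [resolvent_iter f ys s k] for [S_{k+1}], with [S_1 = s], so that the step
    size [1/(n+1)] with [n = k+1] reads [1/(k+2)]. *)
Fixpoint resolvent_iter f (ys : nat -> posop) (s : posop) (n : nat) : posop :=
  if n is k.+1 then
    resolvent f (k.+2%:R^-1) (ys k.+1) (resolvent_iter f ys s k)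
  else s.

End Operators.

Arguments posop1 {R H}.

(** As usual, "operator monotone" refers to operators on all Hilbert spaces
    (equivalently, matrices of all sizes), and includes continuity, without
    which [f(a)] is not defined. *)
Definition operator_monotone (R : realType) (f : R -> R) :=
  (forall t : R, 0 < t -> {for t, continuous f}) /\
  forall (H : hilbertType R) (a b : posop H),
    op_le a b -> op_le (fcalc f a) (fcalc f b).

(** [posop H] with the Borel sigma-algebra of the Thompson metric. *)
Definition borel_posop (R : realType) (H : hilbertType R) :=
  g_sigma_algebraType (@thompson_open R H).

HB.instance Definition _ (R : realType) (H : hilbertType R) :=
  Measurable.on (borel_posop H).

Definition supp (R : realType) (H : hilbertType R)
    (mu : set (borel_posop H) -> \bar R) : set (posop H) :=
  [set x | forall U, thompson_open U -> U x -> (0 < mu U)%E].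

Definition lnplus (R : realType) (t : R) : R := Num.max (ln t) 0.

Definition mutually_independent d d' (T : measurableType d)
    (T' : measurableType d') (R : realType) (P : probability T R)
    (X : nat -> {RV P >-> T'}) :=
  forall (I : {fset nat}) (A : nat -> set T'),
    (forall i, measurable (A i)) ->
    P (\bigcap_(i in [set` I]) (X i @^-1` A i)) =
    (\prod_(i <- I) P (X i @^-1` A i))%E.

Arguments mutually_independent {d d' T T' R} P X.

Definition iid_with_law d d' (T : measurableType d)
    (T' : measurableType d') (R : realType) (P : probability T R)
    (X : nat -> {RV P >-> T'}) (mu : probability T' R) :=
  mutually_independent P X /\
  forall n (A : set T'), measurable A -> distribution P (X n) A = mu A.

Arguments iid_with_law {d d' T T' R} P X mu.

(* Main.v *)
Require Import Defs.
From mathcomp Require Import all_boot all_order all_algebra.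
From mathcomp Require Import finmap complex sesquilinear.
From mathcomp Require Import zify ring lra.
From mathcomp Require Import all_classical all_reals all_analysis measurable_realfun.

Set Implicit Arguments.
Unset Strict Implicit.
Unset Printing Implicit Defensive.

Import Order.TTheory GRing.Theory Num.Theory.
Import numFieldNormedType.Exports.

Local Open Scope classical_set_scope.
Local Open Scope complex_scope.
Local Open Scope ring_scope.

(** Why the iteration stays bounded.

    Boundedness in the Thompson metric means that the extreme spectral values
    [nmax (S n)] and [nmin (S n)] stay away from infinity and from 0
    ([thompson_posop1_le]). Both obey a scalar recursion. If [x] solves the
    resolvent equation [lam f_x(y) + log_x z = 0], testing it at near-eigenvectors
    of [x] gives
      [ln (nmax x) <= ln (nmax z) + lam f (nmax y / nmax x)]
    and the reverse inequality for [nmin] ([resolvent_nmax], [resolvent_nmin]):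
    operator monotonicity of [f] replaces [y] by its extreme spectral values, and
    tangent inequalities for the logarithm replace [z] by its own.

    That the iterates do solve the equation has to be proved, since otherwise
    the drift could be missing. The change of variables
    [x = y^{1/2} B y^{1/2}] turns the equation into a scalar one for [B] in terms
    of [C = y^{-1/2} z y^{-1/2}]; its solution is [B = g(C)] for an explicit
    inverse function [g] ([resolvent_exists]).

    With [u n = ln (nmax (S n))] and [a = ln (nmax (Y n))] the recursion reads
    [u (n+1) <= u n + F (a - u (n+1)) / (n+2)], where [F = f o exp] increases and
    takes a negative value [- kap] somewhere, because [f 1 = 0] and [f' 1 = 1].
    By dominated convergence there is a level [L] above which the increments are
    at most [(X - kap) / (n+2)] with [X >= 0] of mean at most [kap / 4]
    ([stochastic_recursion_bounded]). A strong law of large numbers along dyadic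
    blocks (truncation, Chebyshev, Borel-Cantelli, [block_sums_eventually_small])
    shows that almost surely the variables [X] of the block [2^j, 2^(j+1))
    eventually sum to at most [2^j kap / 2]; the drift over the block
    compensates this, so [u] stays bounded ([recursion_bounded]). The argument
    for [- ln (nmin (S n))] is the same with [F s = - f (exp (- s))].

    The functional calculus rests on one fact: for a real polynomial [p] the top
    of the numerical range of [p(a)] is a value of [p] on the spectrum of [a]
    ([nmax_poly_op]), so that the norm of [p(a)] is at most the supremum of [|p|]
    on the spectrum. Together with Weierstrass approximation this yields
    existence, uniqueness, multiplicativity and monotonicity. *)

(** * The underlying real inner product space *)

Section RealStructure.
Variables (R : realType) (H : hilbertType R).
Implicit Types (u v w : H) (s t : R).

(** All estimates take place in the underlying real inner product space: the
    quadratic form of a self-adjoint operator is real, so nothing is lost by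
    taking real parts. *)
Definition nr v : R := complex.Re `|v|.
Definition rip v w : R := complex.Re (hdot H v w).

Lemma normC_nr v : `|v| = (nr v)%:C.
Proof.
have : 0 <= `|v| :> R[i] by [].
by rewrite /nr; case: `|v| => a b; rewrite lecE /= => /andP[/eqP -> _].
Qed.

Lemma le_normC v t : (`|v| <= t%:C) = (nr v <= t).
Proof. by rewrite normC_nr lecR. Qed.

Lemma nr_ge0 v : 0 <= nr v.
Proof. by have := normr_ge0 v; rewrite normC_nr ler0c. Qed.

Lemma nr0 : nr 0 = 0.
Proof. by rewrite /nr normr0. Qed.

Lemma nrN v : nr (- v) = nr v.
Proof. by rewrite /nr normrN. Qed.

Lemma nrB v w : nr (v - w) = nr (w - v).
Proof. by rewrite /nr distrC. Qed.

Lemma nrD v w : nr (v + w) <= nr v + nr w.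
Proof.
by rewrite -lecR rmorphD /= -!normC_nr; apply: ler_normD.
Qed.

Lemma nrDB u v w : nr (v - w) <= nr (v - u) + nr (u - w).
Proof. by rewrite (le_trans _ (nrD _ _)) // addrA subrK. Qed.

Lemma nrCZ (c : R[i]) v : nr (c *: v) = complex.Re `|c| * nr v.
Proof.
by rewrite /nr normrZ (normC_nr v) normc_def /= mul0r subr0.
Qed.

Lemma nrZ t v : nr (t%:C *: v) = `|t| * nr v.
Proof. by rewrite nrCZ normc_def /= expr0n /= addr0 sqrtr_sqr. Qed.

Lemma nr_eq0 v : nr v = 0 -> v = 0.
Proof. by move=> h; apply/normr0_eq0; rewrite normC_nr h. Qed.

Lemma nr_neq0 v : v != 0 -> 0 < nr v.
Proof.
by move=> v0; rewrite lt_neqAle nr_ge0 andbT eq_sym; apply: contra v0 => /eqP /nr_eq0 ->.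
Qed.

Lemma hdotC v w : hdot H v w = (hdot H w v)^*%C.
Proof. by rewrite hermC /= expr0 mul1r. Qed.

Lemma ripC v w : rip v w = rip w v.
Proof. by rewrite /rip hdotC; case: (hdot H w v). Qed.

Lemma ripDl u v w : rip (u + v) w = rip u w + rip v w.
Proof. by rewrite /rip linearDl raddfD. Qed.

Lemma ripNl v w : rip (- v) w = - rip v w.
Proof. by rewrite /rip linearNl raddfN. Qed.

Lemma ripBl u v w : rip (u - v) w = rip u w - rip v w.
Proof. by rewrite ripDl ripNl. Qed.

Lemma ripZl t v w : rip (t%:C *: v) w = t * rip v w.
Proof.
rewrite /rip linearZl_LR /=; case: (hdot H v w) => a b /=.
by rewrite mul0r subr0.
Qed.

Lemma ripDr u v w : rip w (u + v) = rip w u + rip w v.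
Proof. by rewrite !(ripC w) ripDl. Qed.

Lemma ripNr v w : rip w (- v) = - rip w v.
Proof. by rewrite !(ripC w) ripNl. Qed.

Lemma ripBr u v w : rip w (u - v) = rip w u - rip w v.
Proof. by rewrite !(ripC w) ripBl. Qed.

Lemma ripZr t v w : rip w (t%:C *: v) = t * rip w v.
Proof. by rewrite !(ripC w) ripZl. Qed.

Lemma rip0l v : rip 0 v = 0.
Proof. by rewrite /rip linear0l. Qed.

Lemma ripvv v : rip v v = nr v ^+ 2.
Proof. by rewrite /rip -hdot_norm normC_nr -rmorphXn. Qed.

Definition ripE := (ripDl, ripDr, ripNl, ripNr, ripZl, ripZr).

Lemma rip_le v w : `|rip v w| <= nr v * nr w.
Proof.
have [->|v0] := eqVneq v 0; first by rewrite rip0l nr0 mul0r normr0.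
have [w0|w0] := eqVneq w 0; first by rewrite w0 ripC rip0l nr0 mulr0 normr0.
have pv := nr_neq0 v0; have pw := nr_neq0 w0.
have := ripvv ((nr w)%:C *: v - (nr v)%:C *: w).
have := ripvv ((nr w)%:C *: v + (nr v)%:C *: w).
rewrite !ripE !ripvv (ripC w v) => e1 e2.
have h1 := sqr_ge0 (nr ((nr w)%:C *: v + (nr v)%:C *: w)).
have h2 := sqr_ge0 (nr ((nr w)%:C *: v - (nr v)%:C *: w)).
have pvw : 0 < nr v * nr w by rewrite mulr_gt0.
rewrite ler_norml; apply/andP; split.
  by rewrite -(ler_pM2l pvw); nra.
by rewrite -(ler_pM2l pvw); nra.
Qed.

(** Vector norms are complex numbers, so convergence in [H] is formulated with
    complex radii; this is the version with real ones. *)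
Lemma nr_complete (u : nat -> H) :
  (forall e : R, 0 < e -> exists N, forall m n, (N <= m)%N -> (N <= n)%N ->
     nr (u m - u n) <= e) ->
  exists l, forall e, 0 < e -> exists N, forall n, (N <= n)%N -> nr (u n - l) <= e.
Proof.
move=> cu.
have : cauchy (u @ \oo).
  apply/cauchy_ballP => e e0.
  have Ree : 0 < complex.Re e / 2.
    by move: e0; rewrite ltcE /= => /andP[_ ?]; rewrite divr_gt0.
  have [N hN] := cu _ Ree.
  exists (u @` [set n | (N <= n)%N], u @` [set n | (N <= n)%N]) => /=.
    by split; exists N => // n hn; exists n.
  case=> _ _ /= [[m hm <-] [n hn <-]].
  rewrite -ball_normE /=; rewrite normC_nr.
  have /complex_realP [k ek] : e \is Num.real by exact: gtr0_real.
  rewrite ek ltcR; apply: le_lt_trans (hN _ _ hm hn) _.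
  move: Ree; rewrite ek /=; lra.
move=> /cauchy_cvgP /cvg_ex [l ul]; exists l => e e0.
have e0C : 0 < e%:C by rewrite ltcR.
move/cvgrPdist_lt: ul => /(_ _ e0C) [N _ hN]; exists N => n /hN /=.
by rewrite normC_nr ltcR nrB => /ltW.
Qed.

End RealStructure.

(** * Bounded, symmetric and coercive operators *)

Section BoundedOperators.
Variables (R : realType) (H : hilbertType R).
Implicit Types (u v w : H) (s t M : R) (a b : H -> H).

Lemma opD a : linear a -> forall v w, a (v + w) = a v + a w.
Proof. by move=> la v w; have := la 1 v w; rewrite !scale1r. Qed.

Lemma op0 a : linear a -> a 0 = 0.
Proof.
move=> la; have := opD la 0 0; rewrite addr0 => /eqP.
by rewrite -subr_eq0 opprD addrA subrr sub0r oppr_eq0 => /eqP.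
Qed.

Lemma opZ a : linear a -> forall (c : R[i]) v, a (c *: v) = c *: a v.
Proof. by move=> la c v; have := la c v 0; rewrite !addr0 (op0 la) addr0. Qed.

Lemma opN a : linear a -> forall v, a (- v) = - a v.
Proof. by move=> la v; rewrite -scaleN1r opZ // scaleN1r. Qed.

Lemma opB a : linear a -> forall v w, a (v - w) = a v - a w.
Proof. by move=> la v w; rewrite opD // opN. Qed.

Lemma bounded_opE a : bounded_op a <->
  linear a /\ exists2 M, 0 < M & forall v, nr (a v) <= M * nr v.
Proof.
split=> [[la [M hM]]|[la [M M0 hM]]]; split=> //.
  exists (`|M| + 1) => [|v]; first by rewrite ltr_wpDl.
  have := hM v; rewrite (normC_nr v) -rmorphM le_normC => h.
  apply: le_trans h _; rewrite ler_wpM2r ?nr_ge0 //.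
  by rewrite (le_trans (ler_norm M)) // lerDl.
by exists M => v; rewrite (normC_nr v) -rmorphM le_normC.
Qed.

Lemma bounded_lin a : bounded_op a -> linear a.
Proof. by case. Qed.

Lemma bounded_opD a b : bounded_op a -> bounded_op b -> bounded_op (a + b).
Proof.
move=> /bounded_opE[la [M M0 aM]] /bounded_opE[lb [N N0 bN]].
apply/bounded_opE; split.
  by move=> c v w /=; rewrite !fctE la lb scalerDr addrACA.
exists (M + N) => [|v]; first by rewrite addr_gt0.
by rewrite fctE mulrDl (le_trans (nrD _ _)) // lerD.
Qed.

Lemma bounded_opZ (c : R[i]) a : bounded_op a -> bounded_op (fun v => c *: a v).
Proof.
move=> /bounded_opE[la [M M0 aM]]; apply/bounded_opE; split.
  by move=> d v w; rewrite la scalerDr !scalerA [d * c]mulrC.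
exists ((complex.Re `|c| + 1) * M) => [|v].
  rewrite mulr_gt0 // ltr_wpDl // normc_def /=; exact: sqrtr_ge0.
rewrite nrCZ -mulrA ler_pM ?nr_ge0 //; last by rewrite lerDl.
by rewrite normc_def /=; exact: sqrtr_ge0.
Qed.

Lemma bounded_opN a : bounded_op a -> bounded_op (- a).
Proof.
move=> ba; suff -> : - a = fun v => (-1 : R[i]) *: a v by exact: bounded_opZ.
by apply/funext => v; rewrite scaleN1r.
Qed.

Lemma bounded_opB a b : bounded_op a -> bounded_op b -> bounded_op (a - b).
Proof. by move=> ba bb; apply/bounded_opD => //; exact: bounded_opN. Qed.

Lemma bounded_op_comp a b : bounded_op a -> bounded_op b -> bounded_op (a \o b).
Proof.
move=> /bounded_opE[la [M M0 aM]] /bounded_opE[lb [N N0 bN]].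
apply/bounded_opE; split; first by move=> c v w /=; rewrite lb la.
exists (M * N) => [|v /=]; first by rewrite mulr_gt0.
by rewrite (le_trans (aM _)) // -mulrA ler_pM2l.
Qed.

Lemma bounded_op_id : bounded_op (id : H -> H).
Proof. by apply/bounded_opE; split=> //; exists 1 => // v; rewrite mul1r. Qed.

Lemma bounded_op0 : bounded_op (0 : H -> H).
Proof.
apply/bounded_opE; split; first by move=> c v w; rewrite scaler0 addr0.
by exists 1 => // v; rewrite nr0 mul1r nr_ge0.
Qed.

Lemma le_norm1 v : (`|v| <= 1) = (nr v <= 1).
Proof. by rewrite normC_nr lecE /= eqxx. Qed.

Lemma opnorm_le a M : 0 <= M -> (forall v, nr (a v) <= M * nr v) ->
  opnorm a <= M.
Proof.
move=> M0 aM; apply: ge_sup.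
  by exists (nr (a 0)); exists 0 => //=; rewrite normr0.
move=> _ [v /= hv <-]; apply: le_trans (aM v) _.
by rewrite ler_piMr // -le_norm1.
Qed.

Lemma nr_opnorm a v : bounded_op a -> nr (a v) <= opnorm a * nr v.
Proof.
move=> /bounded_opE[la [M M0 aM]].
have [->|v0] := eqVneq v 0; first by rewrite op0 // nr0 mulr0.
have pv := nr_neq0 v0.
rewrite -ler_pdivrMr //.
have -> : nr (a v) / nr v = nr (a ((nr v)^-1%:C *: v)).
  by rewrite opZ // nrZ ger0_norm ?invr_ge0 ?nr_ge0 // mulrC.
apply: ub_le_sup; last first.
  exists ((nr v)^-1%:C *: v) => //=.
  by rewrite le_norm1 nrZ ger0_norm ?invr_ge0 ?nr_ge0 // mulVf ?gt_eqF.
exists M => _ [w /= hw <-]; apply: le_trans (aM w) _.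
by rewrite ler_piMr ?(ltW M0) // -le_norm1.
Qed.

(** Self-adjointness tested on the real inner product only. For complex-linear
    operators nothing is lost: testing at ['i *: v] recovers the imaginary
    part, see [sym_selfadjoint]. *)
Definition sym a := forall v w, rip (a v) w = rip v (a w).

Lemma selfadjoint_sym a : selfadjoint a -> sym a.
Proof. by move=> sa v w; rewrite /rip sa. Qed.

Lemma sym_selfadjoint a : linear a -> sym a -> selfadjoint a.
Proof.
move=> la sa v w.
have h1 := sa v w.
have := sa ('i%C *: v) w; rewrite opZ // /rip !linearZl_LR /=.
move: h1; rewrite /rip.
case: (hdot H (a v) w) => x y; case: (hdot H v (a w)) => x' y' /= ->.
by rewrite !mul0r !mul1r !sub0r => /oppr_inj ->.
Qed.

Lemma Im_selfadjoint a v : selfadjoint a -> complex.Im (hdot H (a v) v) = 0.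
Proof.
move=> sa; have := sa v v; rewrite [RHS]hdotC.
case: (hdot H (a v) v) => x y /= [] /eqP.
by rewrite -addr_eq0 -mulr2n mulrn_eq0 /= => /eqP.
Qed.

Lemma op_leE a b : selfadjoint a -> selfadjoint b ->
  op_le a b <-> forall v, rip (a v) v <= rip (b v) v.
Proof.
move=> sa sb; split=> h v; last by rewrite lecE !Im_selfadjoint ?eqxx ?h.
by have := h v; rewrite lecE => /andP[].
Qed.

Lemma symN a : sym a -> sym (- a).
Proof. by move=> sa v w; rewrite !fctE ripNl ripNr sa. Qed.

Lemma sym_sandwich a b : sym a -> sym b -> sym (b \o a \o b).
Proof. by move=> sa sb v w /=; rewrite sb sa sb. Qed.

(** Expand the nonnegative form of [T] at [v - M^-1 T v]. The bound turns small
    values of the form into small vectors [T v], hence near-maximisers of a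
    quadratic form into near-eigenvectors. *)
Lemma psd_nr_le (T : H -> H) M v : linear T -> sym T ->
  (forall w, 0 <= rip (T w) w) -> 0 < M -> (forall w, nr (T w) <= M * nr w) ->
  nr (T v) ^+ 2 <= M * rip (T v) v.
Proof.
move=> lT sT T0 M0 TM.
have := T0 (v - M^-1%:C *: T v).
rewrite opB // opZ // !ripE (sT (T v) v) !ripvv => h.
have h2 : rip (T (T v)) (T v) <= M * nr (T v) ^+ 2.
  apply: le_trans (ler_norm _) _; apply: le_trans (rip_le _ _) _.
  by rewrite expr2 mulrA ler_wpM2r ?nr_ge0.
have M10 : 0 < M^-1 by rewrite invr_gt0.
have h3 : M^-1 * (M^-1 * rip (T (T v)) (T v)) <= M^-1 * nr (T v) ^+ 2.
  by rewrite ler_pM2l // ler_pdivrMl.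
have h4 : M^-1 * nr (T v) ^+ 2 <= rip (T v) v by move: h h3; lra.
by rewrite -(ler_pM2l M10) mulKf // gt_eqF.
Qed.

(** Approximate eigenvalues come with near-eigenvectors, at which quadratic
    forms can be tested; the extreme points of the spectrum of a symmetric
    operator are of this kind. *)
Definition approx_eig a t := forall e, 0 < e ->
  exists2 v, nr v = 1 & nr (a v - t%:C *: v) <= e.

Lemma approx_eig_spectrum a t : bounded_op a ->
  approx_eig a t -> real_spectrum a t.
Proof.
move=> ba h [b [/bounded_opE[lb [M M0 bM]] bK _]].
have e0 : 0 < (2 * M)^-1 by rewrite invr_gt0 mulr_gt0.
have [v v1 hv] := h _ e0.
have := bM (a v - t%:C *: v); have := congr1 (@^~ v) bK; rewrite /= => ->.
rewrite v1 leNgt => /negP; apply.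
apply: le_lt_trans (_ : M * (2 * M)^-1 < _); first by rewrite ler_pM2l.
by rewrite invfM mulrCA mulfV ?gt_eqF // mulr1 invf_lt1 // ltr1n.
Qed.

(** [T x = y] is the fixed point equation of the contraction
    [x - s (T x - y)] for small [s], which Picard iteration solves. *)
Lemma coercive_invertible (T : H -> H) (c : R) : bounded_op T -> sym T ->
  0 < c -> (forall v, c * nr v ^+ 2 <= rip (T v) v) -> invertible_op T.
Proof.
move=> bT sT c0 cT.
have lT := bounded_lin bT.
have /bounded_opE[_ [M M0 TM]] := bT.
have inj v : c * nr v <= nr (T v).
  have [->|v0] := eqVneq v 0; first by rewrite nr0 mulr0 nr_ge0.
  rewrite -(ler_pM2r (nr_neq0 v0)) -mulrA -expr2.
  by rewrite (le_trans (cT v)) // (le_trans (ler_norm _)) // rip_le.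
pose s := c / (M ^+ 2).
have s0 : 0 < s by rewrite divr_gt0 // exprn_gt0.
pose q2 := 1 - s * c.
(* |v - s T v|^2 <= (1 - 2 s c + s^2 M^2) |v|^2, and s^2 M^2 = s c *)
have contr v : nr (v - s%:C *: T v) ^+ 2 <= q2 * nr v ^+ 2.
  rewrite -ripvv !ripE !ripvv (ripC v) /q2.
  have h2 : s * (s * nr (T v) ^+ 2) <= s * (c * nr v ^+ 2).
    rewrite ler_pM2l // /s mulrAC ler_pdivrMr ?exprn_gt0 // -mulrA.
    by rewrite ler_pM2l // mulrC -exprMn lerXn2r ?nnegrE ?mulr_ge0 ?nr_ge0 ?(ltW M0).
  have h1 : s * (c * nr v ^+ 2) <= s * rip (T v) v by rewrite ler_pM2l.
  by move: h1 h2; rewrite !mulrDl; lra.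
pose K v := v - s%:C *: T v.
have KB v w : K v - K w = K (v - w).
  by rewrite /K opB // scalerBr !opprD !opprK addrACA.
have [v0|/existsNP[v0 nv0]] := pselect (forall v : H, v = 0).
  (* on the zero space the contraction factor below need not make sense *)
  exists id; split; first exact: bounded_op_id.
    by apply/funext => v; rewrite (v0 v) /= op0.
  by apply/funext => v; rewrite (v0 v) /= op0.
have q20 : 0 <= q2.
  have := contr v0; have := sqr_ge0 (nr (K v0)); rewrite -/(K v0) => h1 h2.
  have := le_trans h1 h2; rewrite pmulr_lge0 //.
  by rewrite exprn_gt0 // nr_neq0 //; apply/eqP.
pose q := Num.sqrt q2.
have q0 : 0 <= q by exact: sqrtr_ge0.
have q1 : q < 1.
  by rewrite -sqrtr1 ltr_sqrt // /q2 ltrBlDr ltrDl mulr_gt0.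
have Kq v : nr (K v) <= q * nr v.
  rewrite -(@ler_pXn2r _ 2) ?nnegrE ?mulr_ge0 ?nr_ge0 //.
  by rewrite exprMn sqr_sqrtr // contr.
have surj y : exists x, T x = y.
  pose F x := K x + s%:C *: y.
  have FB x x' : F x - F x' = K (x - x').
    by rewrite /F -KB opprD addrACA subrr addr0.
  pose u n := iter n F 0.
  have uB n p : nr (u (n + p)%N - u n) <= q ^+ n * nr (u p).
    elim: n => [|n IH]; first by rewrite add0n /= subr0 expr0 mul1r.
    rewrite addSn /= FB (le_trans (Kq _)) // exprS -mulrA.
    by rewrite ler_wpM2l.
  pose B := nr (u 1%N) / (1 - q).
  have B0 : 0 <= B by rewrite divr_ge0 ?nr_ge0 // subr_ge0 ltW.
  have uBd p : nr (u p) <= B.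
    elim: p => [|p IH]; first by rewrite /= nr0.
    have -> : u p.+1 = (F (u p) - F 0) + u 1%N by rewrite /= subrK.
    rewrite (le_trans (nrD _ _)) // FB subr0.
    apply: le_trans (_ : q * B + nr (u 1%N) <= _).
      by rewrite lerD2r (le_trans (Kq _)) // ler_wpM2l.
    rewrite /B mulrCA -[X in _ + X]mulr1 -mulrDr ler_wpM2l ?nr_ge0 //.
    rewrite -[X in _ + X](@mulfV _ (1 - q)) ?subr_eq0 ?gt_eqF //.
    by rewrite -mulrDl [q + _]addrC subrK mul1r.
  have [l hl] : exists l, forall e : R, 0 < e -> exists N, forall n, (N <= n)%N ->
      nr (u n - l) <= e.
    apply: nr_complete => e e0.
    have [N hN] : exists N, q ^+ N * (2 * (B + 1)) <= e.
      have e1 : 0 < e / (2 * (B + 1)) by rewrite divr_gt0 // mulr_gt0 // ltr_wpDl.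
      have := @cvg_expr R q; rewrite ger0_norm // => /(_ q1).
      move=> /cvgrPdist_lt /(_ _ e1) [N _ hN]; exists N.
      have := hN N (leqnn _); rewrite sub0r normrN ger0_norm ?exprn_ge0 //.
      by rewrite ltr_pdivlMr ?mulr_gt0 ?ltr_wpDl // => /ltW.
    have uN n : (N <= n)%N -> nr (u n - u N) <= q ^+ N * (B + 1).
      move=> Nn; rewrite -(subnKC Nn) (le_trans (uB _ _)) //.
      by rewrite ler_wpM2l ?exprn_ge0 // (le_trans (uBd _)) // lerDl.
    exists N => m n Nm Nn; apply: le_trans (nrDB (u N) _ _) _.
    rewrite (nrB (u N)); have := uN _ Nm; have := uN _ Nn; move: hN; lra.
  exists l.
  have Fl : F l = l.
    apply/eqP; rewrite -subr_eq0; apply/eqP/nr_eq0.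
    apply/eqP; rewrite eq_le nr_ge0 andbT; apply/ler_addgt0Pr => e e0.
    have [N hN] := hl (e / 2) (divr_gt0 e0 (ltr0Sn _ 1)).
    have h1 := hN N (leqnn _); have h2 := hN N.+1 (leqnSn _).
    apply: le_trans (nrDB (u N.+1) _ _) _; rewrite add0r.
    have h3 : nr (F l - u N.+1) <= e / 2.
      rewrite /= FB (le_trans (Kq _)) // nrB (le_trans _ h1) //.
      by rewrite ler_piMl ?nr_ge0 // ltW.
    by move: h2 h3; lra.
  move: Fl; rewrite /F /K -addrA => /eqP; rewrite addrC -subr_eq0 addrK.
  rewrite addrC -scalerBr scaler_eq0 => /orP[/eqP [/eqP]|]; first by rewrite gt_eqF.
  by rewrite subr_eq0 => /eqP.
have [b bK] := choice surj.
have Tinj v w : T v = T w -> v = w.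
  move=> h; apply/eqP; rewrite -subr_eq0; apply/eqP/nr_eq0/eqP.
  rewrite eq_le nr_ge0 andbT -(pmulr_rle0 _ c0) (le_trans (inj _)) //.
  by rewrite opB // h subrr nr0.
exists b; split; last by apply/funext.
  apply/bounded_opE; split.
    by move=> k v w; apply: Tinj; rewrite lT !bK.
  exists c^-1 => [|v]; first by rewrite invr_gt0.
  by rewrite -(ler_pM2l c0) mulVKf ?gt_eqF // (le_trans (inj _)) // bK.
by apply/funext => v; apply: Tinj; rewrite /= bK.
Qed.

(** Invertibility bounds [|v|] by [|a v|], and [psd_nr_le] bounds [|a v|^2] by
    the quadratic form. *)
Lemma posdef_coercive a : posdef a ->
  exists2 c, 0 < c & forall v, c * nr v ^+ 2 <= rip (a v) v.
Proof.
case=> ba sa a0 [b [/bounded_opE[lb [N N0 bN]] bK _]].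
have /bounded_opE[la [M M0 aM]] := ba.
have q0 w : 0 <= rip (a w) w.
  have [->|w0] := eqVneq w 0; first by rewrite op0 // rip0l.
  by have := a0 w w0; rewrite ltcE => /andP[_ /ltW].
exists (M * N ^+ 2)^-1 => [|v]; first by rewrite invr_gt0 mulr_gt0 ?exprn_gt0.
have h := psd_nr_le v la (selfadjoint_sym sa) q0 M0 aM.
rewrite ler_pdivrMl ?mulr_gt0 ?exprn_gt0 //.
have -> : M * N ^+ 2 * rip (a v) v = N ^+ 2 * (M * rip (a v) v) by ring.
apply: le_trans (_ : N ^+ 2 * nr (a v) ^+ 2 <= _); last first.
  by rewrite ler_pM2l ?exprn_gt0.
rewrite -exprMn lerXn2r ?nnegrE ?mulr_ge0 ?nr_ge0 ?(ltW N0) //.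
by rewrite -[in leLHS](congr1 (@^~ v) bK : b (a v) = v).
Qed.

Lemma coercive_posdef a (c : R) : bounded_op a -> sym a -> 0 < c ->
  (forall v, c * nr v ^+ 2 <= rip (a v) v) -> posdef a.
Proof.
move=> ba sa c0 ca; split => //.
- exact: sym_selfadjoint (bounded_lin ba) sa.
- move=> v v0; rewrite ltcE Im_selfadjoint /= ?eqxx /=; last first.
    exact: sym_selfadjoint (bounded_lin ba) sa.
  by rewrite (lt_le_trans _ (ca v)) // mulr_gt0 // exprn_gt0 // nr_neq0.
- exact: coercive_invertible ba sa c0 ca.
Qed.

End BoundedOperators.

(** * Numerical range and spectrum *)

Section NumericalRange.
Variables (R : realType) (H : hilbertType R).
Hypothesis nontrivial : exists v : H, v != 0.
Implicit Types (u v w : H) (s t M : R) (a b : H -> H).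

(** For a bounded symmetric operator these are the extreme points of the
    spectrum: they are approximate eigenvalues, and they enclose the spectrum. *)
Definition nmax a : R := sup [set rip (a v) v | v in [set v : H | nr v = 1]].
Definition nmin a : R := - nmax (- a).

Lemma unit_vector : exists v : H, nr v = 1.
Proof.
have [v v0] := nontrivial; have pv := nr_neq0 v0.
exists ((nr v)^-1%:C *: v).
by rewrite nrZ ger0_norm ?invr_ge0 ?nr_ge0 // mulVf ?gt_eqF.
Qed.

Lemma nmax_le a M : (forall v, rip (a v) v <= M * nr v ^+ 2) -> nmax a <= M.
Proof.
move=> aM; apply: ge_sup; first by have [v v1] := unit_vector; exists (rip (a v) v); exists v.
by move=> _ [v /= v1 <-]; rewrite (le_trans (aM v)) // v1 expr1n mulr1.
Qed.

Lemma nmax_ub a v : bounded_op a -> rip (a v) v <= nmax a * nr v ^+ 2.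
Proof.
move=> /bounded_opE[la [M M0 aM]].
have [->|v0] := eqVneq v 0; first by rewrite op0 // rip0l nr0 expr0n mulr0.
have pv := nr_neq0 v0.
rewrite -ler_pdivrMr ?exprn_gt0 //.
have -> : rip (a v) v / nr v ^+ 2 =
    rip (a ((nr v)^-1%:C *: v)) ((nr v)^-1%:C *: v).
  by rewrite opZ // ripZl ripZr mulrA mulrC -expr2 exprVn.
apply: ub_le_sup; last first.
  exists ((nr v)^-1%:C *: v) => //=.
  by rewrite nrZ ger0_norm ?invr_ge0 ?nr_ge0 // mulVf ?gt_eqF.
exists M => _ [w /= hw <-]; apply: le_trans (ler_norm _) _.
by rewrite (le_trans (rip_le _ _)) // hw mulr1 -[leRHS]mulr1 -[in leRHS]hw.
Qed.

Lemma nmin_ge a M : (forall v, M * nr v ^+ 2 <= rip (a v) v) -> M <= nmin a.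
Proof.
move=> aM; rewrite /nmin lerNr; apply: nmax_le => v.
by rewrite fctE ripNl mulNr lerN2.
Qed.

Lemma nmin_lb a v : bounded_op a -> nmin a * nr v ^+ 2 <= rip (a v) v.
Proof.
move=> ba; have := nmax_ub v (bounded_opN ba).
by rewrite fctE ripNl /nmin mulNr lerNl.
Qed.

Lemma approx_eigN a t : approx_eig (- a) t -> approx_eig a (- t).
Proof.
move=> h e e0; have [v v1 hv] := h e e0; exists v => //.
by rewrite rmorphN /= scaleNr opprK -nrN opprD.
Qed.

(** Apply [psd_nr_le] to the positive operator [nmax a - a] at a
    near-maximiser of the quadratic form. *)
Lemma approx_eig_nmax a : bounded_op a -> sym a -> approx_eig a (nmax a).
Proof.
move=> ba sa e e0.
pose T v := (nmax a)%:C *: v - a v.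
have bT : bounded_op T.
  by apply: (bounded_opB (bounded_opZ (nmax a)%:C (@bounded_op_id R H)) ba).
have sT : sym T by move=> v w; rewrite ripBl ripBr sa ripZl ripZr.
have T0 w : 0 <= rip (T w) w.
  by rewrite ripBl ripZl ripvv subr_ge0 nmax_ub.
have /bounded_opE[lT [M M0 TM]] := bT.
have d0 : 0 < e ^+ 2 / M by rewrite divr_gt0 // exprn_gt0.
have hs : has_sup [set rip (a v) v | v in [set v : H | nr v = 1]].
  split; first by have [v v1] := unit_vector; exists (rip (a v) v); exists v.
  exists (nmax a) => _ [v /= v1 <-].
  by have := nmax_ub v ba; rewrite v1 expr1n mulr1.
have [_ [v /= v1 <-] hv] := sup_adherent d0 hs.
exists v => //.
rewrite nrB -(@ler_pXn2r _ 2) ?nnegrE ?nr_ge0 ?(ltW e0) //.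
apply: le_trans (psd_nr_le v lT sT T0 M0 TM) _.
rewrite ripBl ripZl ripvv v1 expr1n mulr1.
rewrite -ler_pdivlMl // mulrC lerBlDl -lerBlDr.
exact: ltW.
Qed.

Lemma approx_eig_nmin a : bounded_op a -> sym a -> approx_eig a (nmin a).
Proof.
move=> ba sa; apply: approx_eigN; apply: approx_eig_nmax; last exact: symN.
exact: bounded_opN.
Qed.

Lemma invertible_opN a : invertible_op a -> invertible_op (- a).
Proof.
move=> [b [bb bK aK]]; have lb := bounded_lin bb.
have aN v : a (b v) = v := congr1 (@^~ v) aK.
have bN v : b (a v) = v := congr1 (@^~ v) bK.
exists (fun v => b (- v)); split.
- by apply: (bounded_op_comp bb); exact: (bounded_opN (@bounded_op_id R H)).
- by apply/funext => v /=; rewrite fctE opprK bN.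
- by apply/funext => v /=; rewrite fctE aN opprK.
Qed.

(** Beyond [nmax a] the operator [t - a] is coercive. *)
Lemma spectrum_le_nmax a t : bounded_op a -> sym a -> real_spectrum a t ->
  t <= nmax a.
Proof.
move=> ba sa nt; rewrite leNgt; apply/negP => ht; apply: nt.
have -> : (fun v => a v - t%:C *: v) = - (fun v => t%:C *: v - a v).
  by apply/funext => v; rewrite fctE opprB.
apply: invertible_opN.
apply: (@coercive_invertible _ _ _ (t - nmax a)).
- exact: (bounded_opB (bounded_opZ t%:C (@bounded_op_id R H)) ba).
- by move=> v w; rewrite ripBl ripBr sa ripZl ripZr.
- by rewrite subr_gt0.
- by move=> v; rewrite ripBl ripZl ripvv mulrBl lerD2l lerN2; exact: nmax_ub.
Qed.

Lemma nmin_le_spectrum a t : bounded_op a -> sym a -> real_spectrum a t ->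
  nmin a <= t.
Proof.
move=> ba sa nt; rewrite /nmin lerNl; apply: spectrum_le_nmax.
- exact: bounded_opN.
- exact: symN.
- move=> /invertible_opN; congr (~ _): nt => //; congr invertible_op.
  by apply/funext => v; rewrite !fctE rmorphN /= scaleNr opprK opprD opprK.
Qed.

End NumericalRange.

(** * Polynomials of an operator *)

Section Polynomials.
Variables (R : realType) (H : hilbertType R).
Implicit Types (u v w : H) (s t M : R) (a b : H -> H) (p q : {poly R[i]}).

(** [poly_op] with complex coefficients, needed to split real polynomials
    into linear factors. *)
Definition cpoly p a v : H := \sum_(i < size p) p`_i *: iter i a v.

Lemma cpolyE n p a v : (size p <= n)%N ->
  cpoly p a v = \sum_(i < n) p`_i *: iter i a v.
Proof.
move=> sp; rewrite /cpoly (big_ord_widen _ (fun i => p`_i *: iter i a v) sp).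
rewrite big_mkcond /=; apply: eq_bigr => i _.
by case: ltnP => // hi; rewrite nth_default // scale0r.
Qed.

Lemma cpoly0 a v : cpoly 0 a v = 0.
Proof. by rewrite /cpoly size_poly0 big_ord0. Qed.

Lemma cpolyD p q a v : cpoly (p + q) a v = cpoly p a v + cpoly q a v.
Proof.
pose n := maxn (size p) (size q).
rewrite !(@cpolyE n) ?leq_maxl ?leq_maxr ?size_polyD // -big_split /=.
by apply: eq_bigr => i _; rewrite coefD scalerDl.
Qed.

Lemma cpolyZ c p a v : cpoly (c *: p) a v = c *: cpoly p a v.
Proof.
rewrite (@cpolyE (size p)) ?size_scale_leq // /cpoly scaler_sumr.
by apply: eq_bigr => i _; rewrite coefZ scalerA.
Qed.

Lemma cpolyC c a v : cpoly c%:P a v = c *: v.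
Proof.
rewrite (@cpolyE 1) ?size_polyC_leq1 // big_ord_recl big_ord0 /= addr0.
by rewrite coefC.
Qed.

Lemma cpolyMX p a v : cpoly (p * 'X) a v = cpoly p a (a v).
Proof.
rewrite (@cpolyE (size p).+1); last first.
  by rewrite (leq_trans (size_polyMleq _ _)) // size_polyX addn2.
rewrite big_ord_recl /= coefMX /= scale0r add0r /cpoly.
by apply: eq_bigr => i _; rewrite coefMX /= -iterSr.
Qed.

Lemma cpolyXM p a v : linear a -> cpoly p a (a v) = a (cpoly p a v).
Proof.
move=> la; rewrite /cpoly; elim/big_ind2: _ => [|x _ y _ -> ->|i _].
- by rewrite op0.
- by rewrite opD.
- by rewrite opZ // -iterS iterSr.
Qed.

Lemma cpolyM p q a v : linear a -> cpoly (p * q) a v = cpoly p a (cpoly q a v).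
Proof.
move=> la; elim/poly_ind: p v => [|p c IH] v.
  by rewrite mul0r !cpoly0.
rewrite mulrDl mul_polyC -mulrA ['X * _]mulrC mulrA !cpolyD cpolyZ !cpolyMX cpolyC.
by rewrite IH cpolyXM.
Qed.

Lemma cpoly_linear_factor (r : R[i]) a v : cpoly ('X - r%:P) a v = a v - r *: v.
Proof.
rewrite cpolyD -['X]mul1r cpolyMX -[1]/(1%:P) cpolyC scale1r.
by rewrite -polyCN cpolyC scaleNr.
Qed.

Lemma bounded_cpoly p a : bounded_op a -> bounded_op (cpoly p a).
Proof.
move=> ba; rewrite /cpoly.
have bi i : bounded_op (iter i a).
  by elim: i => [|i IH]; [exact: bounded_op_id|exact: (bounded_op_comp ba IH)].
elim: (size p) => [|n IH].
  have -> : (fun v => \sum_(i < 0) p`_i *: iter i a v) = 0.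
    by apply/funext => v; rewrite big_ord0.
  exact: bounded_op0.
have -> : (fun v => \sum_(i < n.+1) p`_i *: iter i a v) =
    (fun v => \sum_(i < n) p`_i *: iter i a v) + (fun v => p`_n *: iter n a v).
  by apply/funext => v; rewrite big_ord_recr.
by apply: bounded_opD => //; exact: bounded_opZ.
Qed.

Definition bounded_below (T : H -> H) :=
  exists2 c : R, 0 < c & forall v, c * nr v <= nr (T v).

(** The polynomial splits into linear factors, and a composition of operators
    that are bounded below is bounded below. *)
Lemma bounded_below_cpoly p a : linear a -> p != 0 ->
  (forall r, root p r -> bounded_below (fun v => a v - r *: v)) ->
  bounded_below (cpoly p a).
Proof.
move=> la p0 hr.
have [s es] := closed_field_poly_normal p.
have {}hr r : r \in s -> bounded_below (fun v => a v - r *: v).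
  by move=> rs; apply: hr; rewrite es rootZ ?lead_coef_eq0 // root_prod_XsubC.
have [c c0 hc] : bounded_below (cpoly (\prod_(z <- s) ('X - z%:P)) a).
  elim: s hr {es} => [|r s IH] hr.
    exists 1 => // v; rewrite big_nil -[1 in leRHS]/(1%:P) cpolyC scale1r.
    by rewrite mul1r.
  have [|c c0 hc] := IH; first by move=> z zs; apply: hr; rewrite inE zs orbT.
  have [|d d0 hd] := hr r; first by rewrite inE eqxx.
  exists (d * c) => [|v]; first exact: mulr_gt0.
  rewrite big_cons cpolyM // cpoly_linear_factor.
  by rewrite (le_trans _ (hd _)) // -mulrA ler_pM2l.
have l0 : lead_coef p != 0 by rewrite lead_coef_eq0.
have n0 : 0 < complex.Re `|lead_coef p|.
  by move: l0; rewrite -normr_gt0 ltcE => /andP[].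
exists (complex.Re `|lead_coef p| * c) => [|v]; first exact: mulr_gt0.
by rewrite es cpolyZ nrCZ lead_coefZ (monicP (monic_prod_XsubC _ _ _)) mulr1 -mulrA ler_pM2l.
Qed.

(** For [r = s + i t] the cross terms cancel and
    [|(a - s - i t) v|^2 = |(a - s) v|^2 + t^2 |v|^2]. *)
Lemma bounded_below_nonreal a (r : R[i]) : linear a -> sym a ->
  complex.Im r != 0 -> bounded_below (fun v => a v - r *: v).
Proof.
case: r => s t la sa /= t0; exists `|t| => [|v]; first by rewrite normr_gt0.
pose w := a v - s%:C *: v.
have iw : complex.Im (hdot H w v) = 0.
  rewrite /w linearBl linearZl_LR raddfB /= (Im_selfadjoint v (sym_selfadjoint la sa)).
  have := ripvv v; have -> : hdot H v v = (nr v ^+ 2)%:C.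
    by rewrite -hdot_norm normC_nr rmorphXn.
  by rewrite /= mulr0 mul0r addr0 subr0.
have -> : a v - (s +i* t) *: v = w - (0 +i* t) *: v.
  rewrite /w -addrA -opprD -scalerDl; congr (_ - _ *: _).
  by rewrite /real_complex_def; simpc.
have h : rip w ((0 +i* t) *: v) = 0.
  rewrite ripC /rip linearZl_LR /= hdotC.
  by move: iw; case: (hdot H w v) => x y /= ->; rewrite oppr0 mulr0 mul0r subr0.
rewrite -(@ler_pXn2r _ 2) ?nnegrE ?mulr_ge0 ?nr_ge0 //.
have n1 : nr ((0 +i* t) *: v) = `|t| * nr v.
  by rewrite nrCZ normc_def /= expr0n /= add0r sqrtr_sqr.
clearbody w; rewrite -ripvv ripBl !ripBr h ripC h !ripvv n1.
by rewrite subr0 sub0r opprK exprMn ler_wpDl // sqr_ge0.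
Qed.

Lemma not_bounded_below_approx_eig a t : linear a ->
  ~ bounded_below (fun v => a v - t%:C *: v) -> approx_eig a t.
Proof.
move=> la nb e e0; apply: contrapT => h; apply: nb; exists e => // v.
have [->|v0] := eqVneq v 0; first by rewrite nr0 mulr0 nr_ge0.
have pv := nr_neq0 v0; rewrite leNgt; apply/negP => hv; apply: h.
exists ((nr v)^-1%:C *: v).
  by rewrite nrZ ger0_norm ?invr_ge0 ?nr_ge0 // mulVf ?gt_eqF.
rewrite opZ // scalerA mulrC -scalerA -scalerBr nrZ.
rewrite ger0_norm ?invr_ge0 ?nr_ge0 //.
by rewrite ler_pdivrMl // mulrC ltW.
Qed.

Implicit Type P : {poly R}.

Lemma poly_opE P a : poly_op P a = cpoly (map_poly (real_complex R) P) a.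
Proof.
apply/funext => v; rewrite /poly_op (@cpolyE (size P)) ?size_map_poly //.
by apply: eq_bigr => i _; rewrite coef_map.
Qed.

Lemma bounded_poly_op P a : bounded_op a -> bounded_op (poly_op P a).
Proof. by move=> ba; rewrite poly_opE; exact: bounded_cpoly. Qed.

Lemma sym_poly_op P a : sym a -> sym (poly_op P a).
Proof.
move=> sa v w; rewrite /poly_op.
have si i : sym (iter i a).
  by elim: i => // i IH u z; rewrite iterS sa IH -iterSr.
elim: (size P) => [|n IH]; first by rewrite !big_ord0 rip0l ripC rip0l.
by rewrite !big_ord_recr /= ripDl ripDr IH ripZl ripZr si.
Qed.

Lemma poly_opD P Q a v : poly_op (P + Q) a v = poly_op P a v + poly_op Q a v.
Proof. by rewrite !poly_opE rmorphD cpolyD. Qed.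

Lemma poly_opZ t P a v : poly_op (t *: P) a v = t%:C *: poly_op P a v.
Proof. by rewrite !poly_opE map_polyZ cpolyZ. Qed.

Lemma poly_opM P Q a v : linear a ->
  poly_op (P * Q) a v = poly_op P a (poly_op Q a v).
Proof. by move=> la; rewrite !poly_opE rmorphM cpolyM. Qed.

Lemma poly_opC t a v : poly_op t%:P a v = t%:C *: v.
Proof. by rewrite poly_opE map_polyC cpolyC. Qed.

Lemma poly_opX a v : poly_op 'X a v = a v.
Proof.
by rewrite poly_opE map_polyX -['X]mul1r cpolyMX -[1]/(1%:P) cpolyC scale1r.
Qed.

Lemma poly_opB P Q a v : poly_op (P - Q) a v = poly_op P a v - poly_op Q a v.
Proof.
by rewrite poly_opD -scaleN1r poly_opZ rmorphN /= scaleN1r.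
Qed.

Hypothesis nontrivial : exists v : H, v != 0.

(** Spectral mapping for the top of the numerical range. If the lemma failed,
    every root of [P - nmax (P(a))] would give a linear factor bounded below, so
    [P(a) - nmax (P(a))] would be bounded below. *)
Lemma nmax_poly_op P a : bounded_op a -> sym a ->
  exists2 r, real_spectrum a r & nmax (poly_op P a) = P.[r].
Proof.
move=> ba sa; have la := bounded_lin ba.
pose b := poly_op P a; pose m := nmax b.
have bb : bounded_op b := bounded_poly_op P ba.
have am : approx_eig b m.
  by apply: (approx_eig_nmax nontrivial bb); exact: sym_poly_op.
pose Q := P - m%:P.
have [Q0|Q0] := eqVneq Q 0.
  exists (nmax a).
    exact: (approx_eig_spectrum ba (approx_eig_nmax nontrivial ba sa)).
  have := congr1 (horner^~ (nmax a)) Q0; rewrite /Q hornerD hornerN hornerC horner0.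
  by move/eqP; rewrite subr_eq0 => /eqP ->.
apply: contrapT => hn.
have : bounded_below (cpoly (map_poly (real_complex R) Q) a).
  apply: bounded_below_cpoly => //; first by rewrite map_poly_eq0.
  case=> s t hr.
  have [t0|t0] := eqVneq t 0; last exact: bounded_below_nonreal.
  move: hr; rewrite t0 -[s +i* 0]/(s%:C) /root horner_map => /eqP/complexI.
  rewrite hornerD hornerN hornerC => /eqP; rewrite subr_eq0 => /eqP Ps.
  apply: contrapT => /(not_bounded_below_approx_eig la) /(approx_eig_spectrum ba) hs.
  by apply: hn; exists s.
rewrite -poly_opE => -[c c0 hc].
have [v v1 hv] := am (c / 2) (divr_gt0 c0 (ltr0Sn _ 1)).
have := hc v; rewrite poly_opB poly_opC v1; move: hv c0; rewrite -/b; lra.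
Qed.

Lemma poly_op_le P a c : bounded_op a -> sym a ->
  (forall t, real_spectrum a t -> P.[t] <= c) ->
  forall v, rip (poly_op P a v) v <= c * nr v ^+ 2.
Proof.
move=> ba sa hP v; apply: le_trans (nmax_ub v (bounded_poly_op P ba)) _.
rewrite ler_wpM2r ?sqr_ge0 //.
by have [r hr ->] := nmax_poly_op P ba sa; exact: hP.
Qed.

(** Apply [poly_op_le] to the square of [P]. *)
Lemma nr_poly_op P a c : bounded_op a -> sym a -> 0 <= c ->
  (forall t, real_spectrum a t -> `|P.[t]| <= c) ->
  forall v, nr (poly_op P a v) <= c * nr v.
Proof.
move=> ba sa c0 hP v.
rewrite -(@ler_pXn2r _ 2) ?nnegrE ?mulr_ge0 ?nr_ge0 // exprMn -ripvv.
rewrite -(sym_poly_op P sa) -(poly_opM _ _ _ (bounded_lin ba)) -expr2.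
apply: poly_op_le => // t ht; rewrite horner_exp -[_ ^+ 2]real_normK ?num_real //.
by rewrite lerXn2r ?nnegrE ?hP.
Qed.

End Polynomials.

(** * Weierstrass approximation *)

Section Weierstrass.
Variable R : realType.
Implicit Types (f : R -> R) (g h : nat -> R) (x t c d e : R) (n k : nat).

(** Bernstein polynomials, by recursion on [n]: [(bern n g).[x]] is the
    expectation of [g S] where [S] counts the successes in [n] independent
    trials of probability [x]; the recursion conditions on one trial. *)
Fixpoint bern n g : {poly R} :=
  if n is m.+1 then 'X * bern m (g \o S) + (1 - 'X) * bern m g else (g 0)%:P.

Lemma bernS n g x :
  (bern n.+1 g).[x] = x * (bern n (g \o S)).[x] + (1 - x) * (bern n g).[x].
Proof. by rewrite /= !hornerE. Qed.

Lemma bern_le n g h x : 0 <= x <= 1 -> (forall k, (k <= n)%N -> g k <= h k) ->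
  (bern n g).[x] <= (bern n h).[x].
Proof.
move=> /andP[x0 x1]; elim: n g h => [|n IH] g h gh; first by rewrite !hornerC gh.
rewrite !bernS lerD // ler_wpM2l ?subr_ge0 //; apply: IH => k kn /=; apply: gh => //.
exact: leqW.
Qed.

Lemma bern_affine n g c d x :
  (bern n (fun k => c * g k + d)).[x] = c * (bern n g).[x] + d.
Proof.
elim: n g => [|n IH] g; first by rewrite !hornerC.
rewrite !bernS IH (_ : _ \o S = (fun k => c * (g \o S) k + d)) // IH.
by ring.
Qed.

(** Conditioning on one trial moves the centre by one, so the induction runs
    over an arbitrary centre [c]; for [c = n x] this is the binomial variance. *)
Lemma bern_second_moment n c x :
  (bern n (fun k => (k%:R - c) ^+ 2)).[x] = n%:R * (x * (1 - x)) + (n%:R * x - c) ^+ 2.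
Proof.
elim: n c => [|n IH] c; first by rewrite hornerC /= mulr0n !mul0r !add0r.
rewrite bernS (_ : _ \o S = (fun k => (k%:R - (c - 1)) ^+ 2)) ?IH.
  by rewrite -natr1; ring.
by apply/funext => k /=; rewrite -natr1; ring.
Qed.

Lemma segment_uniform_continuity f (a b : R) :
  (forall t, a <= t <= b -> {for t, continuous f}) ->
  forall e, 0 < e -> exists2 d : R, 0 < d & forall x y, a <= x <= b ->
    `|x - y| < d -> `|f x - f y| <= e.
Proof.
move=> cf e e0.
pose P d x := forall y, `|x - y| < d -> `|f x - f y| <= e.
have cov : \forall d \near (0 : R)^'+, `[a, b]%classic `<=` P d.
  have := @segment_compact R a b; rewrite compact_near_coveringP; apply => x xab.
  have /cf /cvgrPdist_le /(_ _ (divr_gt0 e0 (ltr0Sn _ 1))) : a <= x <= b.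
    by move: xab; rewrite /= in_itv.
  rewrite -nbhs_nearE => /nbhs_ballP [r /= r0 hr].
  exists (ball x (r / 2), [set d | d < r / 2]) => /=.
    split; first by apply: nbhsx_ballx; rewrite divr_gt0.
    by apply: nbhs_right_lt; rewrite divr_gt0.
  move=> [x' d] /= [hx' hd] y hy.
  have h1 : `|f x - f x'| <= e / 2.
    by apply: hr; rewrite /ball /= (lt_le_trans hx') // ler_pdivrMr // ler_peMr ?(ltW r0) // ler1n.
  have h2 : `|f x - f y| <= e / 2.
    apply: hr; rewrite /ball /= (le_lt_trans (ler_distD x' _ _)) //.
    by move: hx'; rewrite /ball /=; move: hy hd; lra.
  rewrite (le_trans (ler_distD (f x) _ _)) // distrC.
  by move: h1 h2; lra.
near (0 : R)^'+ => d; exists d => // x y hx.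
by apply: (near cov d) => //=; rewrite in_itv.
Unshelve. all: by end_near. Qed.

(** Bernstein's proof: the Bernstein polynomial averages [f] over points whose
    mean square distance from [t] is of order [1 / n]. *)
Lemma weierstrass f (a b : R) : a < b ->
  (forall t, a <= t <= b -> {for t, continuous f}) ->
  forall e, 0 < e -> exists p : {poly R}, forall t, a <= t <= b -> `|f t - p.[t]| <= e.
Proof.
move=> ab cf e e0.
have [K K0 hK] : exists2 K : R, 0 < K & forall t, a <= t <= b -> `|f t| <= K.
  have cn : {within `[a, b], continuous (fun t => `|f t|)}.
    apply: continuous_in_subspaceT => t; rewrite inE /= in_itv /= => ht.
    by apply: continuous_comp; [exact: cf|exact: norm_continuous].
  have [c _ hc] := EVT_max (ltW ab) cn.
  exists (`|f c| + 1) => [|t ht]; first by rewrite ltr_wpDl.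
  by rewrite (le_trans (hc t _)) ?in_itv //= lerDl.
have [d d0 hd] := segment_uniform_continuity cf (divr_gt0 e0 (ltr0Sn _ 1)).
pose w := b - a; have w0 : 0 < w by rewrite subr_gt0.
pose C := 2 * K * w ^+ 2 / d ^+ 2.
have C0 : 0 < C by rewrite divr_gt0 ?mulr_gt0 ?exprn_gt0.
have [n hn] : exists n, C / n.+1%:R <= e / 2.
  exists (Num.truncn (C / (e / 2))).
  rewrite ler_pdivrMr // mulrC -ler_pdivrMr ?divr_gt0 //.
  by apply/ltW/truncnS_gt.
pose g k := f (a + w * (k%:R / n.+1%:R)).
exists (bern n.+1 g \Po (w^-1 *: ('X - a%:P))) => t ht.
rewrite horner_comp hornerZ hornerXsubC.
set x := w^-1 * (t - a).
have et : t = a + w * x by rewrite /x mulVKf ?gt_eqF // addrC subrK.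
have x01 : 0 <= x <= 1.
  move/andP: ht => [ta tb]; rewrite /x mulr_ge0 ?invr_ge0 ?subr_ge0 ?(ltW ab) //=.
  by rewrite ler_pdivrMl // mulr1 lerD2r.
have n0 : 0 < n.+1%:R :> R by rewrite ltr0n.
(* uniform continuity when k / n is close to x, the sup bound K otherwise *)
have gk k : (k <= n.+1)%N ->
    `|g k - f t| <= C / n.+1%:R ^+ 2 * (k%:R - n.+1%:R * x) ^+ 2 + e / 2.
  move=> kn; have k01 : 0 <= (k%:R / n.+1%:R : R) <= 1.
    by rewrite divr_ge0 //= ler_pdivrMr // mul1r ler_nat.
  have hk : a <= a + w * (k%:R / n.+1%:R) <= b.
    case/andP: k01 => k0 k1; rewrite lerDl mulr_ge0 ?(ltW w0) //= -lerBrDl.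
    by rewrite ler_piMr // ltW.
  pose y := a + w * (k%:R / n.+1%:R).
  have exy : C / n.+1%:R ^+ 2 * (k%:R - n.+1%:R * x) ^+ 2 = 2 * K * ((y - t) / d) ^+ 2.
    rewrite et /y /C.
    by field; rewrite gt_eqF //= gt_eqF.
  rewrite exy /g -/y.
  have [hy|hy] := ltP `|y - t| d.
    apply: le_trans (hd _ _ hk hy) _.
    by rewrite lerDr mulr_ge0 ?sqr_ge0 // mulr_ge0 // ltW.
  have h1 : 1 <= ((y - t) / d) ^+ 2.
    rewrite -[leRHS]real_normK ?num_real // normrM normfV (gtr0_norm d0).
    by rewrite exprn_ege1 // ler_pdivlMr // mul1r.
  apply: (@le_trans _ _ (2 * K)).
    rewrite (le_trans (ler_normB _ _)) // mulr_natl mulr2n lerD //; exact: hK.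
  apply: (@le_trans _ _ (2 * K * ((y - t) / d) ^+ 2)).
    by rewrite ler_peMr // mulr_ge0 // ltW.
  by rewrite lerDl divr_ge0 // ltW.
have S2 : (bern n.+1 (fun k => C / n.+1%:R ^+ 2 * (k%:R - n.+1%:R * x) ^+ 2 + e / 2)).[x] <= e.
  rewrite bern_affine bern_second_moment subrr expr0n addr0.
  rewrite [leRHS](splitr e) lerD2r (le_trans _ hn) //.
  have -> : C / n.+1%:R ^+ 2 * (n.+1%:R * (x * (1 - x))) = C / n.+1%:R * (x * (1 - x)).
    by field; rewrite gt_eqF.
  case/andP: x01 => x0 x1; apply: ler_piMr; first by rewrite divr_ge0 // ltW.
  by apply: mulr_ile1; rewrite ?subr_ge0 ?gerBl.
rewrite ler_norml; apply/andP; split.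
  rewrite lerNl opprB; apply: le_trans S2.
  have <- : (bern n.+1 (fun k => 1 * g k + - f t)).[x] = (bern n.+1 g).[x] - f t.
    by rewrite bern_affine mul1r.
  by apply: bern_le => // k /gk; rewrite mul1r; exact/le_trans/ler_norm.
apply: le_trans S2.
have <- : (bern n.+1 (fun k => -1 * g k + f t)).[x] = f t - (bern n.+1 g).[x].
  by rewrite bern_affine mulN1r addrC.
apply: bern_le => // k /gk; rewrite distrC mulN1r addrC.
exact/le_trans/ler_norm.
Qed.

End Weierstrass.

(** * Continuous functional calculus *)

Section FunctionalCalculus.
Variables (R : realType) (H : hilbertType R).
Hypothesis nontrivial : exists v : H, v != 0.
Variable a : H -> H.
Hypotheses (ba : bounded_op a) (sa : sym a).
Implicit Types (u v w : H) (s t M e : R) (b c : H -> H) (f g : R -> R).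
Implicit Types (p q : {poly R}).

Let la : linear a := bounded_lin ba.

Lemma is_fcalcE f b : is_fcalc f a b <-> bounded_op b /\
  forall e, 0 < e -> exists2 p, (forall t, real_spectrum a t -> `|f t - p.[t]| <= e) &
    forall v, nr (b v - poly_op p a v) <= e * nr v.
Proof.
split=> -[bb h]; split=> // e e0.
  have [p [h1 h2]] := h e e0; exists p => // v.
  have bp : bounded_op (b - poly_op p a) by apply: bounded_opB => //; exact: bounded_poly_op.
  by rewrite (le_trans (nr_opnorm v bp)) // ler_wpM2r ?nr_ge0.
by have [p h1 h2] := h e e0; exists p; split=> //; apply: opnorm_le => //; exact: ltW.
Qed.

(** The polynomials of the definition may be replaced by any polynomial close
    to [f] on the spectrum, because [nr_poly_op] controls the difference of two
    such polynomials; uniqueness and the norm bound follow. *)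
Lemma fcalc_poly_close f b q e : is_fcalc f a b -> 0 <= e ->
  (forall t, real_spectrum a t -> `|f t - q.[t]| <= e) ->
  forall v, nr (b v - poly_op q a v) <= e * nr v.
Proof.
move=> /is_fcalcE[bb h] e0 hq v; apply/ler_addgt0Pr => d d0.
have n0 : 0 < 2 * (nr v + 1) by rewrite mulr_gt0 // ltr_wpDl ?nr_ge0.
have d'0 : 0 < d / (2 * (nr v + 1)) by rewrite divr_gt0.
have [p h1 h2] := h _ d'0; move: d'0 h1 h2; set d' := d / _ => d'0 h1 h2.
have pq : nr (poly_op p a v - poly_op q a v) <= (d' + e) * nr v.
  rewrite -poly_opB; apply: nr_poly_op => //; first by rewrite addr_ge0 // ltW.
  move=> t ht; rewrite hornerD hornerN (le_trans (ler_distD (f t) _ _)) //.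
  by rewrite lerD ?hq // distrC h1.
apply: le_trans (nrDB (poly_op p a v) _ _) _.
apply: le_trans (lerD (h2 v) pq) _.
have -> : d = d' * 2 * (nr v + 1) by rewrite /d' -mulrA mulfVK // gt_eqF.
by move: d'0; lra.
Qed.

Lemma fcalc_unique f g b c : is_fcalc f a b -> is_fcalc g a c ->
  (forall t, real_spectrum a t -> f t = g t) -> b = c.
Proof.
move=> fb gc fg; apply/funext => v; apply/eqP; rewrite -subr_eq0; apply/eqP/nr_eq0.
apply/eqP; rewrite eq_le nr_ge0 andbT; apply/ler_addgt0Pr => e e0; rewrite add0r.
have n0 : 0 < 2 * (nr v + 1) by rewrite mulr_gt0 // ltr_wpDl ?nr_ge0.
have d'0 : 0 < e / (2 * (nr v + 1)) by rewrite divr_gt0.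
have /is_fcalcE[_ h] := fb.
have [p h1 h2] := h _ d'0; move: d'0 h1 h2; set d := e / _ => d0 h1 h2.
have h3 := @fcalc_poly_close g c p d gc (ltW d0) _ v.
apply: le_trans (nrDB (poly_op p a v) _ _) _.
apply: le_trans (lerD (h2 v) _) _.
  by rewrite nrB; apply: h3 => t ht; rewrite -fg // h1.
have -> : e = d * 2 * (nr v + 1) by rewrite /d -mulrA mulfVK // gt_eqF.
by move: d0; lra.
Qed.

Lemma fcalc_norm f b M : is_fcalc f a b -> 0 <= M ->
  (forall t, real_spectrum a t -> `|f t| <= M) -> forall v, nr (b v) <= M * nr v.
Proof.
move=> fb M0 fM v; have := @fcalc_poly_close f b 0 M fb M0 _ v.
rewrite -polyC0 poly_opC scale0r subr0; apply=> t ht.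
by rewrite hornerC subr0 fM.
Qed.

Lemma is_fcalc_poly p : is_fcalc (horner p) a (poly_op p a).
Proof.
apply/is_fcalcE; split; first exact: bounded_poly_op.
move=> e e0; exists p => [t _|v]; first by rewrite subrr normr0 ltW.
by rewrite subrr nr0 mulr_ge0 ?nr_ge0 // ltW.
Qed.

Lemma is_fcalc_id : is_fcalc id a a.
Proof.
have := is_fcalc_poly 'X.
have -> : poly_op 'X a = a by apply/funext => v; rewrite poly_opX.
by congr is_fcalc; apply/funext => t; rewrite hornerX.
Qed.

Lemma is_fcalc_cst s : is_fcalc (fun=> s) a (fun v => s%:C *: v).
Proof.
have := is_fcalc_poly s%:P.
have -> : poly_op s%:P a = (fun v => s%:C *: v) by apply/funext => v; rewrite poly_opC.
by congr is_fcalc; apply/funext => t; rewrite hornerC.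
Qed.

Lemma is_fcalcD f g b c : is_fcalc f a b -> is_fcalc g a c ->
  is_fcalc (f \+ g) a (b + c).
Proof.
move=> /is_fcalcE[bb fb] /is_fcalcE[bc gc]; apply/is_fcalcE.
split=> [|e e0]; first exact: bounded_opD.
have e2 : 0 < e / 2 by rewrite divr_gt0.
have [p p1 p2] := fb _ e2; have [q q1 q2] := gc _ e2.
exists (p + q) => [t ht|v].
  rewrite /= hornerD opprD addrACA (le_trans (ler_normD _ _)) //.
  by rewrite [leRHS]splitr lerD ?p1 ?q1.
rewrite fctE poly_opD opprD addrACA (le_trans (nrD _ _)) //.
by rewrite [e]splitr mulrDl lerD.
Qed.

Lemma spectrum_bounded : exists2 A : R, 0 <= A & forall t, real_spectrum a t -> `|t| <= A.
Proof.
exists (Num.max `|nmin a| `|nmax a|); first by rewrite le_max normr_ge0.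
move=> t ht; have := spectrum_le_nmax ba sa ht.
have := nmin_le_spectrum ba sa ht.
rewrite le_max => h1 h2; case: (lerP 0 t) => t0; apply/orP; [right|left].
  by rewrite ger0_norm // (le_trans h2) // ler_norm.
by rewrite ltr0_norm // -[leRHS]normrN (le_trans _ (ler_norm _)) // lerN2.
Qed.

Lemma poly_bounded p A : 0 <= A ->
  exists2 K : R, 0 <= K & forall t, `|t| <= A -> `|p.[t]| <= K.
Proof.
move=> A0; elim/poly_ind: p => [|p s [K K0 hK]].
  by exists 0 => // t _; rewrite horner0 normr0.
exists (K * A + `|s|); first by rewrite addr_ge0 // mulr_ge0.
move=> t ht; rewrite hornerD hornerMX hornerC (le_trans (ler_normD _ _)) // lerD2r.
by rewrite normrM ler_pM // hK.
Qed.

(** [f g - p q = f (g - q) + (f - p) q], on the spectrum and for operators. *)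
Lemma is_fcalcM f g b c : is_fcalc f a b -> is_fcalc g a c ->
  is_fcalc (f \* g) a (b \o c).
Proof.
move=> /is_fcalcE[bb fb] /is_fcalcE[bc gc]; apply/is_fcalcE.
split=> [|e e0]; first exact: bounded_op_comp.
have [A A0 hA] := spectrum_bounded.
have [p0 hp0 _] := fb 1 ltr01.
have [K K0 hK] := poly_bounded p0 A0.
have /bounded_opE[lb [M M0 bM]] := bb.
pose B := Num.max (K + 1) M.
have B0 : 0 < B by rewrite lt_max M0 orbT.
have fB t : real_spectrum a t -> `|f t| <= B.
  move=> ht; rewrite le_max; apply/orP; left.
  rewrite -[f t](subrK p0.[t]) (le_trans (ler_normD _ _)) // addrC.
  by rewrite lerD ?hp0 ?hK ?hA.
have bB v : nr (b v) <= B * nr v.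
  by rewrite (le_trans (bM v)) // ler_wpM2r ?nr_ge0 // le_max lexx orbT.
have e1 : 0 < e / 2 / B by rewrite !divr_gt0.
have [q q1 q2] := gc _ e1.
have [K' K'0 hK'] := poly_bounded q A0.
have K1 : 0 < K' + 1 by rewrite ltr_wpDl.
have e2 : 0 < e / 2 / (K' + 1) by rewrite !divr_gt0.
have [p p1 p2] := fb _ e2.
have qK v : nr (poly_op q a v) <= (K' + 1) * nr v.
  apply: nr_poly_op => //; first exact: ltW.
  by move=> t ht; rewrite (le_trans (hK' t (hA t ht))) // lerDl.
exists (p * q) => [t ht|v].
  rewrite /= hornerM.
  have -> : f t * g t - p.[t] * q.[t] = f t * (g t - q.[t]) + (f t - p.[t]) * q.[t].
    by ring.
  rewrite (le_trans (ler_normD _ _)) // !normrM [leRHS]splitr lerD //.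
    have -> : e / 2 = B * (e / 2 / B) by field; rewrite gt_eqF.
    by rewrite ler_pM ?fB ?q1.
  have -> : e / 2 = (e / 2 / (K' + 1)) * (K' + 1) by field; rewrite gt_eqF.
  by rewrite ler_pM ?p1 // (le_trans (hK' t (hA t ht))) // lerDl.
rewrite poly_opM //= (le_trans (nrDB (b (poly_op q a v)) _ _)) //.
rewrite -opB // [e in leRHS]splitr mulrDl lerD //.
  have -> : e / 2 * nr v = B * (e / 2 / B * nr v) by field; rewrite gt_eqF.
  by rewrite (le_trans (bB _)) // ler_pM2l.
apply: le_trans (p2 _) _.
have -> : e / 2 * nr v = e / 2 / (K' + 1) * ((K' + 1) * nr v).
  by rewrite mulrA mulfVK // gt_eqF.
by rewrite ler_pM2l.
Qed.

Lemma is_fcalcZ f b s : is_fcalc f a b -> is_fcalc (fun t => s * f t) a (fun v => s%:C *: b v).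
Proof. by move=> fb; exact: (is_fcalcM (is_fcalc_cst s) fb). Qed.

Lemma fcalc_sym f b : is_fcalc f a b -> sym b.
Proof.
move=> /is_fcalcE[bb fb] v w; apply/eqP; rewrite -subr_eq0 -normr_eq0 eq_le normr_ge0 andbT.
apply/ler_addgt0Pr => e e0; rewrite add0r.
have n0 : 0 < 2 * (nr v * nr w + 1) by rewrite mulr_gt0 // ltr_wpDl // mulr_ge0 // nr_ge0.
have d0 : 0 < e / (2 * (nr v * nr w + 1)) by rewrite divr_gt0.
have [p _ hp] := fb _ d0.
have -> : rip (b v) w - rip v (b w) =
    rip (b v - poly_op p a v) w - rip v (b w - poly_op p a w).
  by rewrite ripBl ripBr (sym_poly_op p sa v w); ring.
rewrite (le_trans (ler_normB _ _)) //.
move: hp d0; set d := e / _ => hp d0.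
have -> : e = d * (nr v * nr w + 1) + d * (nr v * nr w + 1).
  by rewrite /d; field; rewrite gt_eqF // ltr_wpDl // mulr_ge0 // nr_ge0.
have h x y : nr (b x - poly_op p a x) * nr y <= d * (nr x * nr y + 1).
  rewrite mulrDr mulr1; apply: le_trans (_ : d * (nr x * nr y) <= _); last by rewrite lerDl ltW.
  by rewrite mulrA ler_wpM2r ?nr_ge0.
apply: lerD; first by apply: le_trans (rip_le _ _) _; exact: h.
by rewrite ripC (mulrC (nr v)); apply: le_trans (rip_le _ _) _; exact: h.
Qed.

Lemma fcalc_le f g b c : is_fcalc f a b -> is_fcalc g a c ->
  (forall t, real_spectrum a t -> f t <= g t) ->
  forall v, rip (b v) v <= rip (c v) v.
Proof.
move=> /is_fcalcE[_ fb] /is_fcalcE[_ gc] fg v; apply/ler_addgt0Pr => e e0.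
have n0 : 0 < 4 * (nr v ^+ 2 + 1) by rewrite mulr_gt0 // ltr_wpDl // sqr_ge0.
have d0 : 0 < e / (4 * (nr v ^+ 2 + 1)) by rewrite divr_gt0.
have [p p1 p2] := fb _ d0; have [q q1 q2] := gc _ d0.
move: d0 p1 p2 q1 q2; set d := e / _ => d0 p1 p2 q1 q2.
have dz x y : nr (x - y) <= d * nr v -> rip x v <= rip y v + d * nr v ^+ 2.
  move=> h; rewrite -lerBlDl -ripBl (le_trans (ler_norm _)) // (le_trans (rip_le _ _)) //.
  by rewrite expr2 mulrA ler_wpM2r ?nr_ge0.
have h1 := dz _ _ (p2 v).
have h2 : rip (poly_op q a v) v <= rip (c v) v + d * nr v ^+ 2 by apply: dz; rewrite nrB.
have : rip (poly_op (p - q) a v) v <= 2 * d * nr v ^+ 2.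
  apply: poly_op_le => // t ht; rewrite hornerD hornerN.
  move: (p1 t ht) (q1 t ht) (fg t ht); rewrite !ler_norml => /andP[? ?] /andP[? ?] ?; lra.
rewrite poly_opB ripBl => h3.
have -> : e = d * (4 * (nr v ^+ 2 + 1)) by rewrite /d mulfVK // gt_eqF.
move: h1 h2 h3 d0; nra.
Qed.

(** For a polynomial [p] this holds because [p - p(t)] is divisible by
    ['X - t]. *)
Lemma fcalc_approx_eig f b t : is_fcalc f a b -> real_spectrum a t ->
  forall e, 0 < e -> exists2 d : R, 0 < d & forall v, nr v = 1 ->
    nr (a v - t%:C *: v) <= d -> nr (b v - (f t)%:C *: v) <= e.
Proof.
move=> /is_fcalcE[_ fb] ht e e0.
have e3 : 0 < e / 3 by rewrite divr_gt0.
have [p p1 p2] := fb _ e3.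
have /factor_theorem[q eq] : root (p - (p.[t])%:P) t.
  by rewrite /root hornerD hornerN hornerC subrr.
have /bounded_opE[_ [M M0 qM]] := bounded_poly_op q ba.
exists (e / 3 / M) => [|v v1 hv]; first by rewrite divr_gt0.
apply: le_trans (nrDB (poly_op p a v) _ _) _.
apply: le_trans (lerD (p2 v) (nrDB ((p.[t])%:C *: v) _ _)) _.
have -> : poly_op p a v - (p.[t])%:C *: v = poly_op q a (a v - t%:C *: v).
  rewrite -(poly_opC p.[t] a) -poly_opB eq poly_opM //.
  by rewrite poly_opB poly_opX poly_opC.
rewrite -scalerBl -rmorphB nrZ v1 !mulr1.
have h1 : nr (poly_op q a (a v - t%:C *: v)) <= e / 3.
  rewrite (le_trans (qM _)) // mulrC -ler_pdivlMr //.
have h2 := p1 t ht; rewrite distrC.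
move: h1 h2; lra.
Qed.

(** Weierstrass polynomials on an interval that contains the spectrum form a
    Cauchy sequence in operator norm, whose pointwise limit is [f(a)]. The
    interval is enlarged by 1 so that it is nondegenerate. *)
Lemma is_fcalc_exists f :
  (forall t, nmin a <= t <= nmax a + 1 -> {for t, continuous f}) ->
  exists b, is_fcalc f a b.
Proof.
move=> cf.
have mM : nmin a < nmax a + 1.
  have [v v1] := unit_vector nontrivial.
  have := nmin_lb v ba; have := nmax_ub v ba; rewrite v1 expr1n !mulr1; lra.
have sp t : real_spectrum a t -> nmin a <= t <= nmax a + 1.
  move=> ht; have := spectrum_le_nmax ba sa ht.
  have := nmin_le_spectrum ba sa ht; lra.
have W n : exists p : {poly R}, forall t, real_spectrum a t -> `|f t - p.[t]| <= n.+1%:R^-1.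
  have n0 : 0 < n.+1%:R^-1 :> R by rewrite invr_gt0.
  have [p hp] := weierstrass mM cf n0.
  by exists p => t /sp; exact: hp.
have [P hP] := choice W.
have PP m n v : nr (poly_op (P m) a v - poly_op (P n) a v) <=
    (m.+1%:R^-1 + n.+1%:R^-1) * nr v.
  rewrite -poly_opB; apply: nr_poly_op => // t ht.
  rewrite hornerD hornerN (le_trans (ler_distD (f t) _ _)) // distrC.
  by rewrite lerD // hP.
have inv_small e : 0 < e -> exists N, forall n, (N <= n)%N -> n.+1%:R^-1 <= e :> R.
  move=> e0; exists (Num.truncn e^-1) => n hn.
  rewrite -[e]invrK lef_pV2 ?posrE ?invr_gt0 //.
  by rewrite (le_trans (ltW (truncnS_gt _))) // ler_nat ltnS.
have L v : exists l, forall e : R, 0 < e -> exists N, forall n, (N <= n)%N ->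
    nr (poly_op (P n) a v - l) <= e.
  apply: nr_complete => e e0.
  have e1 : 0 < e / (2 * (nr v + 1)) by rewrite divr_gt0 // mulr_gt0 // ltr_wpDl ?nr_ge0.
  have [N hN] := inv_small _ e1; exists N => m n Nm Nn.
  have -> : e = e / (2 * (nr v + 1)) * 2 * (nr v + 1).
    by rewrite -mulrA mulfVK // gt_eqF // mulr_gt0 // ltr_wpDl ?nr_ge0.
  rewrite (le_trans (PP m n v)) //; apply: ler_pM; rewrite ?nr_ge0 ?lerDl //.
  by rewrite mulr_natr mulr2n lerD // hN.
have [b hb] := choice L.
have bP n v : nr (b v - poly_op (P n) a v) <= n.+1%:R^-1 * nr v.
  apply/ler_addgt0Pr => e e0.
  have e1 : 0 < e / 2 / (nr v + 1) by rewrite !divr_gt0 // ltr_wpDl ?nr_ge0.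
  have [N hN] := hb v _ (divr_gt0 e0 (ltr0Sn _ 1)).
  have [N' hN'] := inv_small _ e1.
  pose m := maxn N N'.
  have h1 := hN m (leq_maxl _ _); have h2 := hN' m (leq_maxr _ _).
  apply: le_trans (nrDB (poly_op (P m) a v) _ _) _; rewrite nrB.
  apply: le_trans (lerD h1 (PP m n v)) _.
  rewrite mulrDl.
  have : m.+1%:R^-1 * nr v <= e / 2.
    have -> : e / 2 = e / 2 / (nr v + 1) * (nr v + 1).
      by rewrite mulfVK // gt_eqF // ltr_wpDl ?nr_ge0.
    by apply: ler_pM; rewrite ?nr_ge0 ?lerDl.
  move: (m.+1%:R^-1 * nr v) (n.+1%:R^-1 * nr v) => x y; lra.
exists b; apply/is_fcalcE; split; last first.
  move=> e e0; have [N hN] := inv_small _ e0; exists (P N) => [t ht|v].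
    by rewrite (le_trans (hP N t ht)) // hN.
  by rewrite (le_trans (bP N v)) // ler_wpM2r ?nr_ge0 ?hN.
have lP n : linear (poly_op (P n) a) by case: (bounded_poly_op (P n) ba).
apply/bounded_opE; split.
  move=> k v w; apply/eqP; rewrite -subr_eq0; apply/eqP/nr_eq0.
  apply/eqP; rewrite eq_le nr_ge0 andbT; apply/ler_addgt0Pr => e e0; rewrite add0r.
  pose K := nr (k *: v + w) + complex.Re `|k| * nr v + nr w + 1.
  have k0 : 0 <= complex.Re `|k| by rewrite normc_def /=; exact: sqrtr_ge0.
  have K0 : 0 < K by rewrite ltr_wpDl // !addr_ge0 ?mulr_ge0 ?nr_ge0.
  have [N hN] := inv_small _ (divr_gt0 e0 K0).
  have {}hN := hN N (leqnn _).
  have -> : b (k *: v + w) - (k *: b v + b w) =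
     (b (k *: v + w) - poly_op (P N) a (k *: v + w)) -
     (k *: (b v - poly_op (P N) a v) + (b w - poly_op (P N) a w)).
    rewrite lP scalerBr [k *: b v - _ + _]addrACA -opprD [in RHS]opprB.
    by rewrite [RHS]addrA subrK.
  apply: le_trans (nrD _ _) _; rewrite nrN.
  apply: le_trans (lerD (bP N _) (nrD _ _)) _.
  rewrite nrCZ addrA.
  apply: le_trans (lerD (lerD (lexx _) (ler_wpM2l k0 (bP N v))) (bP N w)) _.
  have -> : N.+1%:R^-1 * nr (k *: v + w) + complex.Re `|k| * (N.+1%:R^-1 * nr v) +
    N.+1%:R^-1 * nr w = N.+1%:R^-1 * (K - 1) by rewrite /K; ring.
  have -> : e = e / K * K by rewrite mulfVK // gt_eqF.
  apply: ler_pM => //; last by rewrite gerBl.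
  by rewrite /K addrK !addr_ge0 ?mulr_ge0 ?nr_ge0.
have /bounded_opE[_ [M M0 hM]] := bounded_poly_op (P 0%N) ba.
exists (1 + M) => [|v]; first by rewrite addr_gt0.
rewrite -[b v](subrK (poly_op (P 0%N) a v)) (le_trans (nrD _ _)) // mulrDl lerD //.
by rewrite (le_trans (bP 0%N v)) // invr1.
Qed.

End FunctionalCalculus.

(** * Positive definite operators *)

Section PositiveOperators.
Variables (R : realType) (H : hilbertType R).
Hypothesis nontrivial : exists v : H, v != 0.
Implicit Types (u v w : H) (s t e c lam : R) (f : R -> R) (x y z : posop H).

Lemma posop_bounded x : bounded_op x.
Proof. by case: x => a []. Qed.

Lemma posop_sym x : sym x.
Proof. by case: x => a [ba sa _ _] /=; exact: selfadjoint_sym. Qed.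

Lemma posop_lin x : linear x.
Proof. exact: bounded_lin (posop_bounded x). Qed.

Lemma nmin_gt0 x : 0 < nmin x.
Proof.
have [c c0 hc] := posdef_coercive (posopP x).
exact: lt_le_trans c0 (nmin_ge nontrivial hc).
Qed.

Lemma nmin_le_nmax x : nmin x <= nmax x.
Proof.
have [v v1] := unit_vector nontrivial.
have := nmin_lb v (posop_bounded x); have := nmax_ub v (posop_bounded x).
by rewrite v1 expr1n !mulr1; exact: (fun h1 h2 => le_trans h2 h1).
Qed.

Lemma nmax_gt0 x : 0 < nmax x.
Proof. exact: lt_le_trans (nmin_gt0 x) (nmin_le_nmax x). Qed.

Lemma posop_spectrum_bounds x t : real_spectrum x t -> nmin x <= t <= nmax x.
Proof.
by move=> ht; rewrite nmin_le_spectrum ?spectrum_le_nmax //;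
  (exact: posop_bounded || exact: posop_sym).
Qed.

Lemma posop_spectrum_gt0 x t : real_spectrum x t -> 0 < t.
Proof. by move=> /posop_spectrum_bounds /andP[h _]; exact: lt_le_trans (nmin_gt0 x) h. Qed.

Definition continuous_pos f := forall t, 0 < t -> {for t, continuous f}.

Lemma fcalcP f x : continuous_pos f -> is_fcalc f x (fcalc f x).
Proof.
move=> cf; apply: (xgetPex 0).
apply: (is_fcalc_exists nontrivial (posop_bounded x) (@posop_sym x)).
by move=> t /andP[h _]; apply: cf; exact: lt_le_trans (nmin_gt0 x) h.
Qed.

Lemma sqrt_continuous_pos : continuous_pos Num.sqrt.
Proof. by move=> t t0; exact: sqrt_continuous. Qed.

Lemma isqrt_continuous_pos : continuous_pos (fun t => (Num.sqrt t)^-1).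
Proof.
move=> t t0; apply: continuous_comp; first exact: sqrt_continuous.
by apply: inv_continuous; rewrite gt_eqF // sqrtr_gt0.
Qed.

Lemma inv_continuous_pos : continuous_pos GRing.inv.
Proof. by move=> t t0; apply: inv_continuous; rewrite gt_eqF. Qed.

Lemma ln_continuous_pos : continuous_pos (@ln R).
Proof. by move=> t t0; exact: continuous_ln. Qed.

Section Roots.
Variable x : posop H.
Local Notation s := (psqrt x).
Local Notation i := (pisqrt x).
Local Notation bx := (posop_bounded x).
Local Notation sx := (@posop_sym x).

Lemma psqrtP : is_fcalc Num.sqrt x s. Proof. exact: (fcalcP x sqrt_continuous_pos). Qed.
Lemma pisqrtP : is_fcalc (fun t => (Num.sqrt t)^-1) x i.
Proof. exact: (fcalcP x isqrt_continuous_pos). Qed.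

Definition pinv := fcalc GRing.inv x.
Lemma pinvP : is_fcalc GRing.inv x pinv.
Proof. exact: (fcalcP x inv_continuous_pos). Qed.

Lemma psqrt_sym : sym s. Proof. exact: (fcalc_sym bx sx psqrtP). Qed.
Lemma pisqrt_sym : sym i. Proof. exact: (fcalc_sym bx sx pisqrtP). Qed.
Lemma pinv_sym : sym pinv. Proof. exact: (fcalc_sym bx sx pinvP). Qed.
Lemma psqrt_bounded : bounded_op s. Proof. by case: psqrtP. Qed.
Lemma pisqrt_bounded : bounded_op i. Proof. by case: pisqrtP. Qed.
Lemma pinv_bounded : bounded_op pinv. Proof. by case: pinvP. Qed.

Lemma psqrtK v : s (s v) = x v.
Proof.
have := fcalc_unique nontrivial bx sx (is_fcalcM nontrivial bx sx psqrtP psqrtP)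
  (is_fcalc_id bx).
move=> /(_ _)/(congr1 (@^~ v)) <- //.
by move=> t /posop_spectrum_gt0 t0 /=; rewrite -expr2 sqr_sqrtr ?ltW.
Qed.

Let fcalc_one b f : is_fcalc f x b -> (forall t, 0 < t -> f t = 1) -> forall v, b v = v.
Proof.
move=> fb f1 v.
have /(_ _)/(congr1 (@^~ v)) := fcalc_unique nontrivial bx sx fb (is_fcalc_cst bx 1).
rewrite scale1r; apply=> t /posop_spectrum_gt0; exact: f1.
Qed.

Lemma psqrtV v : s (i v) = v.
Proof.
apply: (fcalc_one (is_fcalcM nontrivial bx sx psqrtP pisqrtP)) => t t0 /=.
by rewrite mulfV // gt_eqF // sqrtr_gt0.
Qed.

Lemma pisqrtV v : i (s v) = v.
Proof.
apply: (fcalc_one (is_fcalcM nontrivial bx sx pisqrtP psqrtP)) => t t0 /=.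
by rewrite mulVf // gt_eqF // sqrtr_gt0.
Qed.

Lemma pinvK v : pinv (x v) = v.
Proof.
apply: (fcalc_one (is_fcalcM nontrivial bx sx pinvP (is_fcalc_id bx))) => t t0 /=.
by rewrite mulVf // gt_eqF.
Qed.

Lemma pinvKr v : x (pinv v) = v.
Proof.
apply: (fcalc_one (is_fcalcM nontrivial bx sx (is_fcalc_id bx) pinvP)) => t t0 /=.
by rewrite mulfV // gt_eqF.
Qed.

Lemma pisqrtK v : i (i v) = pinv v.
Proof.
have := fcalc_unique nontrivial bx sx (is_fcalcM nontrivial bx sx pisqrtP pisqrtP) pinvP.
move=> /(_ _)/(congr1 (@^~ v)) <- //.
by move=> t /posop_spectrum_gt0 t0 /=; rewrite -invfM -expr2 sqr_sqrtr ?ltW.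
Qed.

Lemma nr_pisqrt v : nr (i v) ^+ 2 = rip (pinv v) v.
Proof. by rewrite -ripvv -(pisqrt_sym (i v)) pisqrtK. Qed.

Lemma nr_psqrt v : nr (s v) ^+ 2 = rip (x v) v.
Proof. by rewrite -ripvv -(psqrt_sym (s v)) psqrtK. Qed.

Lemma pinv_le v : rip (pinv v) v <= (nmin x)^-1 * nr v ^+ 2.
Proof.
have := fcalc_le nontrivial bx sx pinvP (is_fcalc_cst bx (nmin x)^-1).
move=> /(_ _ v); rewrite ripZl ripvv; apply=> t ht.
have /andP[h _] := posop_spectrum_bounds ht.
by rewrite lef_pV2 // posrE ?nmin_gt0 // (posop_spectrum_gt0 ht).
Qed.

Lemma pinv_coercive v : (nmax x)^-1 * nr v ^+ 2 <= rip (pinv v) v.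
Proof.
have := fcalc_le nontrivial bx sx (is_fcalc_cst bx (nmax x)^-1) pinvP.
move=> /(_ _ v); rewrite ripZl ripvv; apply=> t ht.
have /andP[_ h] := posop_spectrum_bounds ht.
by rewrite lef_pV2 // posrE ?nmax_gt0 // (posop_spectrum_gt0 ht).
Qed.

End Roots.

(** Coercivity: [|v| = |x^{1/2} x^{-1/2} v|] is at most a multiple of
    [|x^{-1/2} v|]. *)
Lemma posdef_whiten x y : posdef (pisqrt x \o y \o pisqrt x).
Proof.
have bi := pisqrt_bounded x.
have /bounded_opE[_ [M M0 sM]] := psqrt_bounded x.
have c0 : 0 < nmin y / M ^+ 2 by rewrite divr_gt0 ?nmin_gt0 ?exprn_gt0.
apply: (@coercive_posdef _ _ _ (nmin y / M ^+ 2)) => //.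
- exact: (bounded_op_comp (bounded_op_comp bi (posop_bounded y)) bi).
- by apply: sym_sandwich; [exact: posop_sym|exact: pisqrt_sym].
move=> v; rewrite /= pisqrt_sym.
apply: le_trans (nmin_lb _ (posop_bounded y)).
rewrite -mulrA ler_pM2l ?nmin_gt0 // ler_pdivrMl ?exprn_gt0 //.
rewrite -exprMn lerXn2r ?nnegrE ?mulr_ge0 ?nr_ge0 ?(ltW M0) //.
by rewrite -[in leLHS](psqrtV x v).
Qed.

Definition whiten x y : posop H := PosOp (posdef_whiten x y).

Lemma posdef_scaled_inv c x : 0 < c -> posdef (fun v => c%:C *: pinv x v).
Proof.
move=> c0; apply: (@coercive_posdef _ _ _ (c / nmax x)).
- exact: bounded_opZ (pinv_bounded x).
- by move=> v w; rewrite ripZl ripZr pinv_sym.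
- by rewrite divr_gt0 ?nmax_gt0.
- by move=> v; rewrite ripZl -mulrA ler_pM2l // pinv_coercive.
Qed.

Definition scaled_inv c x (c0 : 0 < c) : posop H := PosOp (posdef_scaled_inv x c0).

Lemma posdef_scalar c : 0 < c -> posdef (fun v : H => c%:C *: v).
Proof.
move=> c0; apply: (@coercive_posdef _ _ _ c) => //.
- exact: bounded_opZ (@bounded_op_id R H).
- by move=> v w; rewrite ripZl ripZr.
- by move=> v; rewrite ripZl ripvv.
Qed.

Lemma rip_whiten x y v : rip (whiten x y v) v = rip (y (pisqrt x v)) (pisqrt x v).
Proof. by rewrite /= pisqrt_sym. Qed.

Lemma whiten_le x y v : rip (whiten x y v) v <= nmax y * rip (pinv x v) v.
Proof. by rewrite rip_whiten -nr_pisqrt; apply: nmax_ub; exact: posop_bounded. Qed.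

Lemma whiten_ge x y v : nmin y * rip (pinv x v) v <= rip (whiten x y v) v.
Proof. by rewrite rip_whiten -nr_pisqrt; apply: nmin_lb; exact: posop_bounded. Qed.

Lemma op_le_posop x y : op_le x y <-> forall v, rip (x v) v <= rip (y v) v.
Proof.
by apply: op_leE; [case: x => a []|case: y => a []].
Qed.

Lemma op_le_fcalc f x y : continuous_pos f -> op_le (fcalc f x) (fcalc f y) ->
  forall v, rip (fcalc f x v) v <= rip (fcalc f y v) v.
Proof.
move=> cf h; have [bx _] := fcalcP x cf; have [by_ _] := fcalcP y cf.
apply/op_leE => //.
  exact: (sym_selfadjoint (bounded_lin bx) (fcalc_sym (posop_bounded x) (@posop_sym x) (fcalcP x cf))).
exact: (sym_selfadjoint (bounded_lin by_) (fcalc_sym (posop_bounded y) (@posop_sym y) (fcalcP y cf))).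
Qed.

(** Compare two scalar operators. *)
Lemma operator_monotone_le f s t : operator_monotone f -> 0 < s -> s <= t -> f s <= f t.
Proof.
move=> [cf mf] s0 st; have t0 := lt_le_trans s0 st.
pose X r (r0 : 0 < r) : posop H := PosOp (posdef_scalar r0).
have val r (r0 : 0 < r) v : nr v = 1 -> rip (fcalc f (X r r0) v) v = f r.
  move=> v1.
  have eqv : (f r)%:C *: v = fcalc f (X r r0) v.
    apply/eqP; rewrite -subr_eq0; apply/eqP/nr_eq0; rewrite nrB.
    apply/eqP; rewrite eq_le nr_ge0 andbT; apply/ler_addgt0Pr => e e0; rewrite add0r.
    have sp : real_spectrum (X r r0) r.
      apply: (approx_eig_spectrum (posop_bounded _)) => d d0.
      by exists v => //=; rewrite subrr nr0 ltW.
    have [d d0] := fcalc_approx_eig (posop_bounded _) (fcalcP (X r r0) cf) sp e0.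
    by apply => //=; rewrite subrr nr0 ltW.
  by rewrite -eqv ripZl ripvv v1 expr1n mulr1.
have [v v1] := unit_vector nontrivial.
rewrite -(val s s0 v v1) -(val t t0 v v1).
apply: (op_le_fcalc cf); apply: mf; apply/op_le_posop => w /=.
by rewrite !ripZl ripvv ler_wpM2r ?sqr_ge0.
Qed.

Lemma opnorm_fcalc_ge f x t : continuous_pos f -> approx_eig x t ->
  `|f t| <= opnorm (fcalc f x).
Proof.
move=> cf ht; have sp := approx_eig_spectrum (posop_bounded x) ht.
apply/ler_addgt0Pr => e e0.
have [d d0 hd] := fcalc_approx_eig (posop_bounded _) (fcalcP x cf) sp e0.
have [v v1 hv] := ht d d0; have := hd v v1 hv => h.
have -> : `|f t| = nr ((f t)%:C *: v) by rewrite nrZ v1 mulr1.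
rewrite -[_ *: v](subrK (fcalc f x v)) (le_trans (nrD _ _)) // addrC nrB lerD //.
have [bf _] := fcalcP x cf.
by have := nr_opnorm v bf; rewrite v1 mulr1.
Qed.

Lemma opnorm_fcalc_le f x M : continuous_pos f -> 0 <= M ->
  (forall t, nmin x <= t <= nmax x -> `|f t| <= M) -> opnorm (fcalc f x) <= M.
Proof.
move=> cf M0 fM; apply: opnorm_le => //.
apply: (fcalc_norm nontrivial (posop_bounded x) (@posop_sym x) (fcalcP x cf) M0).
by move=> t /posop_spectrum_bounds; exact: fM.
Qed.

Lemma ln_le_tangent t c : 0 < t -> 0 < c -> ln t <= ln c - 1 + c^-1 * t.
Proof.
move=> t0 c0; have q0 : 0 < c^-1 * t by rewrite mulr_gt0 // invr_gt0.
have := @le_ln1Dx R (c^-1 * t - 1); rewrite [1 + _]addrC subrK ltrBrDr addNr => /(_ q0).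
by rewrite lnM ?posrE ?invr_gt0 // lnV ?posrE //; lra.
Qed.

Lemma ln_ge_tangent t c : 0 < t -> 0 < c -> ln c + 1 - c / t <= ln t.
Proof.
move=> t0 c0.
have := @ln_le_tangent t^-1 c^-1; rewrite !invr_gt0 => /(_ t0 c0).
by rewrite !lnV ?posrE // invrK; lra.
Qed.

(** [fcalc_approx_eig] applied to the inverse and then to [f]. A single vector
    has to serve all three forms in the resolvent bounds. *)
Lemma joint_approx_eig f c (c0 : 0 < c) x t e : continuous_pos f ->
  approx_eig x t -> 0 < e ->
  exists v, [/\ nr v = 1, `|rip (x v) v - t| <= e, `|rip (pinv x v) v - t^-1| <= e &
    `|rip (fcalc f (scaled_inv x c0) v) v - f (c / t)| <= e].
Proof.
move=> cf ht e0; have sp := approx_eig_spectrum (posop_bounded x) ht.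
have dinv d : 0 < d -> exists2 r : R, 0 < r & forall v, nr v = 1 ->
    nr (x v - t%:C *: v) <= r -> nr (pinv x v - t^-1%:C *: v) <= d.
  by move=> d0; exact: (fcalc_approx_eig (posop_bounded x) (pinvP x) sp d0).
have sinv d : 0 < d -> exists2 r : R, 0 < r & forall v, nr v = 1 ->
    nr (x v - t%:C *: v) <= r -> nr (scaled_inv x c0 v - (c / t)%:C *: v) <= d.
  move=> d0; have [r r0 hr] := dinv (d / c) (divr_gt0 d0 c0).
  exists r => // v v1 /(hr v v1) h /=.
  rewrite rmorphM -scalerA -scalerBr nrZ gtr0_norm // mulrC -ler_pdivlMr //.
have sps : real_spectrum (scaled_inv x c0) (c / t).
  apply: (approx_eig_spectrum (posop_bounded _)) => d d0.
  have [r r0 hr] := sinv d d0; have [v v1 hv] := ht r r0.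
  by exists v => //; exact: hr.
have [d d0 hd] := fcalc_approx_eig (posop_bounded _) (fcalcP (scaled_inv x c0) cf) sps e0.
have [r1 r10 h1] := dinv e e0; have [r2 r20 h2] := sinv d d0.
pose r := Num.min e (Num.min r1 r2).
have r0 : 0 < r by rewrite !lt_min e0 r10.
have [v v1] := ht r r0; rewrite !le_min => /and3P[he hr1 hr2].
have close a s : nr (a v - s%:C *: v) <= e -> `|rip (a v) v - s| <= e.
  move=> h; have -> : s = rip (s%:C *: v) v by rewrite ripZl ripvv v1 expr1n mulr1.
  by rewrite -ripBl (le_trans (rip_le _ _)) // v1 mulr1.
exists v; split => //.
- exact: close.
- by apply: close; exact: h1.
- by apply: close; apply: hd => //; exact: h2.
Qed.

(** * Extreme spectral values of a resolvent *)

Section ResolventBounds.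
Variables (f : R -> R) (lam : R) (x y z : posop H).
Hypotheses (mf : operator_monotone f) (lam0 : 0 < lam).
Hypothesis res : is_resolvent f lam y z x.

Let cf : continuous_pos f := mf.1.

(** Apply the equation at [x^{-1/2} v] and cancel the outer factors [x^{1/2}]. *)
Lemma resolvent_eq v :
  lam * rip (fcalc f (whiten x y) v) v + rip (fcalc (@ln R) (whiten x z) v) v = 0.
Proof.
have := congr1 (@^~ (pisqrt x v)) res; rewrite /fat /= !fctE /= psqrtV => h.
have {h} := congr1 (pisqrt x) h.
have li := bounded_lin (pisqrt_bounded x).
rewrite op0 // opD // (opZ li) !pisqrtV => h.
by rewrite -ripZl -ripDl h rip0l.
Qed.

(** Test the resolvent equation at a near-eigenvector [v] of [x] for [nmax x].
    In the first term, [x^{-1/2} y x^{-1/2} <= nmax y * x^{-1}] and operator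
    monotonicity leave the scalar [f (nmax y / nmax x)]. In the logarithmic
    term the tangent line of [ln] at [nmax z / nmax x] bounds the operator by a
    linear one, whose form at [v] is explicit. *)
Lemma resolvent_nmax : ln (nmax x) <= ln (nmax z) + lam * f (nmax y / nmax x).
Proof.
have xi0 := nmax_gt0 x; have zi0 := nmax_gt0 z.
apply/ler_addgt0Pr => e' e'0.
have K0 : 0 < lam + nmax x by rewrite addr_gt0.
pose e := e' / (lam + nmax x); have e0 : 0 < e by rewrite divr_gt0.
have [v [v1 _ hi hf]] := joint_approx_eig (nmax_gt0 y) cf
  (approx_eig_nmax nontrivial (posop_bounded x) (@posop_sym x)) e0.
have hA : rip (fcalc f (whiten x y) v) v <= f (nmax y / nmax x) + e.
  apply: le_trans (_ : rip (fcalc f (scaled_inv x (nmax_gt0 y)) v) v <= _).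
    apply: (op_le_fcalc cf); apply: mf.2; apply/op_le_posop => w.
    by rewrite /= ripZl; exact: whiten_le.
  by move: hf; rewrite ler_norml => /andP[_]; rewrite lerBlDl.
pose c := nmax z / nmax x; have c0 : 0 < c by rewrite divr_gt0.
pose B := whiten x z; have bB := posop_bounded B; have sB := @posop_sym B.
have hB : rip (fcalc (@ln R) B v) v <= ln c - 1 + c^-1 * rip (B v) v.
  have := fcalc_le nontrivial bB sB (fcalcP B ln_continuous_pos)
    (is_fcalcD bB (is_fcalc_cst bB (ln c - 1))
      (is_fcalcZ nontrivial bB sB c^-1 (is_fcalc_id bB))).
  move=> /(_ _ v); rewrite fctE ripDl !ripZl ripvv v1 expr1n mulr1; apply.
  by move=> t /posop_spectrum_gt0 t0 /=; exact: ln_le_tangent.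
have hB2 : c^-1 * rip (B v) v <= 1 + nmax x * e.
  have h := whiten_le x z v.
  apply: le_trans (_ : c^-1 * (nmax z * rip (pinv x v) v) <= _).
    by rewrite ler_pM2l ?invr_gt0.
  have -> : c^-1 * (nmax z * rip (pinv x v) v) = nmax x * rip (pinv x v) v.
    by rewrite /c; field; rewrite !gt_eqF.
  have : rip (pinv x v) v <= (nmax x)^-1 + e.
    by move: hi; rewrite ler_norml => /andP[_]; rewrite lerBlDl.
  rewrite -(ler_pM2l xi0) => h2; apply: le_trans h2 _.
  by rewrite mulrDr mulfV ?gt_eqF.
have := resolvent_eq v; rewrite -/B => heq.
have : ln c = ln (nmax z) - ln (nmax x) by rewrite lnM ?posrE ?invr_gt0 // lnV ?posrE.
have -> : e' = lam * e + nmax x * e.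
  by rewrite -mulrDl mulrC /e mulfVK // gt_eqF.
move: heq hB hB2; rewrite -(ler_pM2l lam0) in hA; move: hA.
rewrite mulrDr; lra.
Qed.

Lemma pinv_whiten w : pinv (whiten x z) w = psqrt x (pinv z (psqrt x w)).
Proof.
rewrite -[RHS](pinvK (whiten x z)) /=; congr pinv.
by rewrite pisqrtV pinvKr pisqrtV.
Qed.

(** The mirror image of [resolvent_nmax]. A lower bound of [ln] must be a tangent
    in the variable [1 / t], so the inverse [x^{1/2} z^{-1} x^{1/2}] of
    [x^{-1/2} z x^{-1/2}] enters; it is at most [x / nmin z]. *)
Lemma resolvent_nmin : ln (nmin z) + lam * f (nmin y / nmin x) <= ln (nmin x).
Proof.
have xi0 := nmin_gt0 x; have zi0 := nmin_gt0 z.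
apply/ler_addgt0Pr => e' e'0.
have K0 : 0 < lam + (nmin x)^-1 by rewrite addr_gt0 // invr_gt0.
pose e := e' / (lam + (nmin x)^-1); have e0 : 0 < e by rewrite divr_gt0.
have [v [v1 hx _ hf]] := joint_approx_eig (nmin_gt0 y) cf
  (approx_eig_nmin nontrivial (posop_bounded x) (@posop_sym x)) e0.
have hA : f (nmin y / nmin x) - e <= rip (fcalc f (whiten x y) v) v.
  apply: le_trans (_ : _ <= rip (fcalc f (scaled_inv x (nmin_gt0 y)) v) v) _.
    by move: hf; rewrite ler_norml => /andP[+ _]; rewrite lerBrDl addrC.
  apply: (op_le_fcalc cf); apply: mf.2; apply/op_le_posop => w.
  by rewrite /= ripZl; exact: whiten_ge.
pose c := nmin z / nmin x; have c0 : 0 < c by rewrite divr_gt0.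
pose B := whiten x z; have bB := posop_bounded B; have sB := @posop_sym B.
have hB : ln c + 1 - c * rip (pinv B v) v <= rip (fcalc (@ln R) B v) v.
  have := fcalc_le nontrivial bB sB
    (is_fcalcD bB (is_fcalc_cst bB (ln c + 1))
      (is_fcalcZ nontrivial bB sB (- c) (pinvP B))) (fcalcP B ln_continuous_pos).
  move=> /(_ _ v); rewrite fctE ripDl !ripZl ripvv v1 expr1n mulr1 mulNr; apply.
  by move=> t /posop_spectrum_gt0 t0 /=; rewrite mulNr; exact: ln_ge_tangent.
have hB2 : c * rip (pinv B v) v <= 1 + (nmin x)^-1 * e.
  rewrite pinv_whiten psqrt_sym.
  apply: le_trans (_ : c * ((nmin z)^-1 * rip (x v) v) <= _).
    by rewrite ler_pM2l // -nr_psqrt pinv_le.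
  have -> : c * ((nmin z)^-1 * rip (x v) v) = (nmin x)^-1 * rip (x v) v.
    by rewrite /c; field; rewrite !gt_eqF.
  have : rip (x v) v <= nmin x + e.
    by move: hx; rewrite ler_norml => /andP[_]; rewrite lerBlDl.
  have ix0 : 0 < (nmin x)^-1 by rewrite invr_gt0.
  rewrite -(ler_pM2l ix0) => h2; apply: le_trans h2 _.
  by rewrite mulrDr mulVf ?gt_eqF.
have := resolvent_eq v; rewrite -/B => heq.
have : ln c = ln (nmin z) - ln (nmin x) by rewrite lnM ?posrE ?invr_gt0 // lnV ?posrE.
have -> : e' = lam * e + (nmin x)^-1 * e.
  by rewrite -mulrDl mulrC /e mulfVK // gt_eqF.
move: heq hB hB2; rewrite -(ler_pM2l lam0) in hA; move: hA.
rewrite mulrBr; lra.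
Qed.

End ResolventBounds.

(** * The Thompson metric and the extreme spectral values *)

(** [|ln|] of any approximate eigenvalue of [x^{-1/2} y x^{-1/2}] is at most
    [thompson x y]. *)
Lemma thompson_nmin x y e : thompson x y < e -> expR (- e) < nmin (whiten x y).
Proof.
move=> h; have := opnorm_fcalc_ge ln_continuous_pos
  (approx_eig_nmin nontrivial (posop_bounded (whiten x y)) (@posop_sym (whiten x y))).
move=> /le_lt_trans/(_ h); rewrite ltr_norml => /andP[h1 _].
by rewrite -[ltRHS]lnK ?posrE ?nmin_gt0 // ltr_expR.
Qed.

Lemma whitenK x y w : y w = psqrt x (whiten x y (psqrt x w)).
Proof. by rewrite /= pisqrtV psqrtV. Qed.

Lemma whiten_quad x y w : nmin (whiten x y) * rip (x w) w <= rip (y w) w.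
Proof.
rewrite [in leRHS](whitenK x y) psqrt_sym -nr_psqrt.
by apply: nmin_lb; exact: posop_bounded.
Qed.

Lemma nmin_whiten_nmin x y : nmin (whiten x y) * nmin x <= nmin y.
Proof.
apply: (nmin_ge nontrivial) => w; apply: le_trans (whiten_quad x y w).
by rewrite -mulrA ler_pM2l ?nmin_gt0 // nmin_lb //; exact: posop_bounded.
Qed.

Lemma nmin_whiten_nmax x y : nmin (whiten x y) * nmax x <= nmax y.
Proof.
have q0 := nmin_gt0 (whiten x y).
rewrite -ler_pdivlMl //; apply: (nmax_le nontrivial) => w.
rewrite -mulrA ler_pdivlMl //; apply: le_trans (whiten_quad x y w) _.
by apply: nmax_ub; exact: posop_bounded.
Qed.

(** With [thompson_nmin] the two hypotheses on [g] say that [ln g] decreases by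
    at most the Thompson distance. *)
Lemma thompson_open_superlevel (g : posop H -> R) :
  (forall x, 0 < g x) -> (forall x y, nmin (whiten x y) * g x <= g y) ->
  forall c, thompson_open [set x | c < g x].
Proof.
move=> g0 hg c x /= cx.
have [c0|c0] := leP c 0.
  by exists 1 => // y _; exact: le_lt_trans (g0 y).
exists (ln (g x) - ln c); first by rewrite subr_gt0 ltr_ln ?posrE.
move=> y /thompson_nmin h; apply: lt_le_trans (hg x y).
rewrite -ltr_pdivrMr //; apply: le_lt_trans h.
by rewrite opprB expRD expRN !lnK ?posrE.
Qed.

Lemma thompson_posop1_le x M : 0 <= M -> ln (nmax x) <= M -> - M <= ln (nmin x) ->
  thompson x posop1 <= M.
Proof.
move=> M0 h1 h2; rewrite -[thompson _ _]/(opnorm (fcalc (@ln R) (whiten x posop1))).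
apply: (opnorm_fcalc_le ln_continuous_pos M0) => t /andP[ta tb].
have t0 := lt_le_trans (nmin_gt0 _) ta.
have tu : t <= (nmin x)^-1.
  apply: le_trans tb _; apply: (nmax_le nontrivial) => v.
  by rewrite rip_whiten /= ripvv nr_pisqrt pinv_le.
have tl : (nmax x)^-1 <= t.
  apply: le_trans ta; apply: (nmin_ge nontrivial) => v.
  by rewrite rip_whiten /= ripvv nr_pisqrt pinv_coercive.
have := tu; rewrite -ler_ln ?posrE ?invr_gt0 ?nmin_gt0 // lnV ?posrE ?nmin_gt0 // => h3.
have := tl; rewrite -ler_ln ?posrE ?invr_gt0 ?nmax_gt0 // lnV ?posrE ?nmax_gt0 // => h4.
rewrite ler_norml; apply/andP; split; lra.
Qed.

End PositiveOperators.

(** * Existence of the resolvent *)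

Section ResolventExistence.
Variables (R : realType) (H : hilbertType R).
Hypothesis nontrivial : exists v : H, v != 0.
Implicit Types (u v w : H) (s t e lam : R) (f g phi : R -> R) (x y z C : posop H).

Lemma continuous_pos_comp f g : continuous_pos f -> continuous_pos g ->
  (forall t, 0 < t -> 0 < g t) -> continuous_pos (f \o g).
Proof.
by move=> cf cg g0 t t0; apply: continuous_comp; [exact: cg|exact/cf/g0].
Qed.

(** For polynomials [f] both sides agree by induction; a uniform polynomial
    approximation of [f] gives the general case. *)
Lemma fcalc_similar f phi (U V : H -> H) (A C : posop H) :
  continuous_pos f -> continuous_pos phi -> (forall t, 0 < t -> 0 < phi t) ->
  bounded_op U -> bounded_op V -> (forall v, U (V v) = v) -> (forall v, V (U v) = v) ->
  (forall v, A v = U (fcalc phi C (V v))) ->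
  forall v, fcalc f A v = U (fcalc (f \o phi) C (V v)).
Proof.
move=> cf cphi phi0 bU bV UV VU AE.
have bC := posop_bounded C; have sC := @posop_sym _ _ C.
have bA := posop_bounded A; have sA := @posop_sym _ _ A.
have lU := bounded_lin bU; have lV := bounded_lin bV.
have cfphi := continuous_pos_comp cf cphi phi0.
set D := fcalc phi C in AE *.
have DP : is_fcalc phi C D := fcalcP nontrivial C cphi.
have bD : bounded_op D by case: DP.
have lD := bounded_lin bD.
have polyD p : is_fcalc (horner p \o phi) C (poly_op p D).
  elim/poly_ind: p => [|p c IH].
    have -> : horner 0 \o phi = (fun=> 0) by apply/funext => t /=; rewrite horner0.
    have -> : poly_op 0 D = (fun v => (0 : R)%:C *: v).
      by apply/funext => v; rewrite -[0]/(0%:P) poly_opC.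
    exact: is_fcalc_cst.
  have := is_fcalcD bC (is_fcalcM nontrivial bC sC IH DP) (is_fcalc_cst bC c).
  congr is_fcalc; apply/funext => v.
    by rewrite /= hornerD hornerMX hornerC.
  by rewrite fctE poly_opD poly_opM // poly_opX poly_opC.
have polyA p v : poly_op p A v = U (poly_op p D (V v)).
  elim/poly_ind: p v => [|p c IH] v.
    by rewrite -[0]/(0%:P) !poly_opC !scale0r op0.
  rewrite !poly_opD !poly_opM ?poly_opX //; last exact: posop_lin.
  by rewrite !poly_opC opD // (opZ lU) UV IH AE VU.
(* one polynomial approximation of f on an interval containing the spectra of
   A and of phi(C) serves both sides *)
have [m [M [m0 mM hA hphi]]] : exists m M, [/\ 0 < m, m < M,
    (forall t, real_spectrum A t -> m <= t <= M) &
    (forall t, real_spectrum C t -> m <= phi t <= M)].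
  have cphi' : {within `[nmin C, nmax C], continuous phi}.
    apply: continuous_in_subspaceT => t; rewrite inE /= in_itv /= => /andP[h _].
    by apply: cphi; exact: lt_le_trans (nmin_gt0 nontrivial C) h.
  have [c1 hc1 h1] := EVT_min (nmin_le_nmax nontrivial C) cphi'.
  have [c2 hc2 h2] := EVT_max (nmin_le_nmax nontrivial C) cphi'.
  have c1p : 0 < c1.
    by move: hc1; rewrite in_itv /= => /andP[h _]; exact: lt_le_trans (nmin_gt0 nontrivial C) h.
  exists (Num.min (nmin A) (phi c1)), (Num.max (nmax A) (phi c2) + 1); split.
  - by rewrite lt_min (nmin_gt0 nontrivial) phi0.
  - rewrite gt_min; apply/orP; left; rewrite ltr_pwDr // le_max.
    by rewrite (nmin_le_nmax nontrivial).
  - move=> t /(posop_spectrum_bounds) /andP[ta tb].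
    by rewrite ge_min ta /= ler_wpDr // le_max tb.
  - move=> t /(posop_spectrum_bounds) /andP[ta tb].
    have tin : t \in `[nmin C, nmax C] by rewrite in_itv /= ta tb.
    by rewrite ge_min (h1 t tin) orbT /= ler_wpDr // le_max (h2 t tin) orbT.
have cf' t : m <= t <= M -> {for t, continuous f}.
  by move=> /andP[h _]; apply: cf; exact: lt_le_trans m0 h.
have /bounded_opE[_ [MU MU0 hU]] := bU; have /bounded_opE[_ [MV MV0 hV]] := bV.
move=> v; apply/eqP; rewrite -subr_eq0; apply/eqP/nr_eq0/eqP.
rewrite eq_le nr_ge0 andbT; apply/ler_addgt0Pr => e e0; rewrite add0r.
pose K := nr v + MU * (MV * nr v) + 1.
have K0 : 0 < K by rewrite ltr_wpDl // addr_ge0 ?mulr_ge0 ?nr_ge0 // ltW.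
have d0 : 0 < e / K by rewrite divr_gt0.
have [p hp] := weierstrass mM cf' d0.
move: d0 hp; set d := e / K => d0 hp.
have h1 := fcalc_poly_close nontrivial bA sA (fcalcP nontrivial A cf) (ltW d0)
  (fun t ht => hp t (hA t ht)) v.
have h2 w : nr (poly_op p D w - fcalc (f \o phi) C w) <= d * nr w.
  have hZ := is_fcalcD bC (polyD p)
    (is_fcalcZ nontrivial bC sC (-1) (fcalcP nontrivial C cfphi)).
  have := fcalc_norm nontrivial bC sC hZ (ltW d0) _ w.
  have eN (c : H) : (-1 : R)%:C *: c = - c by rewrite rmorphN1 scaleN1r.
  rewrite -eN; apply=> t ht /=.
  by rewrite mulN1r distrC hp // hphi.
apply: le_trans (nrDB (poly_op p A v) _ _) _.
have h3 : nr (poly_op p A v - U (fcalc (f \o phi) C (V v))) <= d * (MU * (MV * nr v)).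
  rewrite polyA -opB // (le_trans (hU _)) // mulrCA ler_pM2l //.
  by rewrite (le_trans (h2 _)) // ler_pM2l.
have -> : e = d * K by rewrite /d mulfVK // gt_eqF.
by rewrite /K !mulrDr mulr1; move: h1 h3 d0; lra.
Qed.

Section Solution.
Variables (f : R -> R) (lam : R).
Hypotheses (cf : continuous_pos f) (lam0 : 0 < lam) (f1 : f 1 = 0).
Hypothesis ndf : forall s t, 0 < s -> s <= t -> f s <= f t.

(** In logarithmic coordinates the scalar resolvent equation reads
    [r - lam f(e^{-r}) = a]; its left-hand side increases at least as fast as
    [r], so the solution is a 1-Lipschitz function of [a]. *)
Lemma scalar_resolvent : exists gam : R -> R,
  (forall a, gam a - lam * f (expR (- gam a)) = a) /\
  (forall a b, `|gam a - gam b| <= `|a - b|).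
Proof.
pose G r := r - lam * f (expR (- r)).
have Gmono r r' : r <= r' -> r' - r <= G r' - G r.
  move=> rr; rewrite /G.
  have : lam * f (expR (- r')) <= lam * f (expR (- r)).
    by rewrite ler_pM2l // ndf ?expR_gt0 // ler_expR lerN2.
  lra.
have G0 : G 0 = 0 by rewrite /G oppr0 expR0 f1 mulr0 subr0.
have cG : continuous G.
  move=> r; apply: cvgB; first exact: cvg_id.
  apply: cvgM; first exact: cvg_cst.
  apply: (@continuous_comp _ _ _ (fun r => expR (- r)) f).
    by apply: continuous_comp; [exact: opp_continuous|exact: continuous_expR].
  exact/cf/expR_gt0.
have ex a : exists r, G r = a.
  have h1 : G (- `|a|) <= a.
    have := Gmono (- `|a|) 0; rewrite G0 oppr_le0 normr_ge0 => /(_ isT).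
    have := ler_norm (- a); rewrite normrN; lra.
  have h2 : a <= G `|a|.
    have := Gmono 0 `|a|; rewrite G0 normr_ge0 => /(_ isT).
    have := ler_norm a; lra.
  have ab : - `|a| <= `|a| by rewrite ge0_cp.
  have [] := @IVT R G (- `|a|) `|a| a ab.
  - exact: continuous_subspaceT.
  - by rewrite ge_min h1 le_max h2 orbT.
  by move=> c _ Gc; exists c.
have [gam hg] := choice ex; exists gam; split=> // a b.
wlog ab : a b / gam a <= gam b => [h|].
  by case: (leP (gam a) (gam b)) => [/h//|/ltW /h]; rewrite distrC [X in _ <= X]distrC.
have := Gmono _ _ ab; rewrite !hg => h.
rewrite distrC [leRHS]distrC ger0_norm ?subr_ge0 //.
exact: le_trans h (ler_norm _).
Qed.

(** Back in multiplicative coordinates: [g] inverts [t exp (- lam f(1 / t))]. *)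
Lemma scalar_resolvent_pos : exists g : R -> R,
  [/\ continuous_pos g, forall t, 0 < t -> 0 < g t &
      forall t, 0 < t -> lam * f (g t)^-1 + ln (t / g t) = 0].
Proof.
have [gam [hg lip]] := scalar_resolvent.
have cgam : continuous gam.
  move=> a; apply/cvgrPdist_le => e e0; near=> b.
  apply: le_trans (lip a b) _; near: b.
  by apply: cvgr_dist_le.
exists (fun t => expR (gam (ln t))); split.
- move=> t t0; apply: (@continuous_comp _ _ _ (fun t => gam (ln t)) expR).
    by apply: continuous_comp; [exact: continuous_ln|exact: cgam].
  exact: continuous_expR.
- by move=> t _; exact: expR_gt0.
- move=> t t0; rewrite ln_div ?posrE ?expR_gt0 // expRK -expRN.
  by have := hg (ln t); lra.
Unshelve. all: by end_near. Qed.

(** Put [C = y^{-1/2} z y^{-1/2}] and [x = y^{1/2} g(C) y^{1/2}]. The operator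
    [U = x^{-1/2} y^{1/2} g(C)^{1/2}] is unitary with adjoint [V]; it conjugates
    [g(C)^{-1}] to [x^{-1/2} y x^{-1/2}] and [C g(C)^{-1}] to
    [x^{-1/2} z x^{-1/2}]. By [fcalc_similar] the resolvent equation becomes the
    scalar equation that defines [g]. *)
Lemma resolvent_exists y z : exists x, is_resolvent f lam y z x.
Proof.
have [g [cg g0 eqg]] := scalar_resolvent_pos.
pose C := whiten nontrivial y z.
have bC := posop_bounded C; have sC := @posop_sym _ _ C.
have csg : continuous_pos (Num.sqrt \o g).
  exact: (continuous_pos_comp (@sqrt_continuous_pos R) cg g0).
have cig : continuous_pos ((fun t => (Num.sqrt t)^-1) \o g).
  exact: (continuous_pos_comp (@isqrt_continuous_pos R) cg g0).
have civ : continuous_pos (GRing.inv \o g).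
  exact: (continuous_pos_comp (@inv_continuous_pos R) cg g0).
have cdv : continuous_pos (id \* (GRing.inv \o g)).
  by move=> t t0; apply: continuousM; [exact: cvg_id|exact: civ].
pose b := fcalc (Num.sqrt \o g) C; pose b' := fcalc ((fun t => (Num.sqrt t)^-1) \o g) C.
have bP : is_fcalc _ C b := fcalcP nontrivial C csg.
have b'P : is_fcalc _ C b' := fcalcP nontrivial C cig.
have bb : bounded_op b by case: bP.
have bb' : bounded_op b' by case: b'P.
have sb : sym b := fcalc_sym bC sC bP.
have isqrt t : 0 < t -> Num.sqrt (g t) != 0 by move=> /g0 h; rewrite gt_eqF // sqrtr_gt0.
have sqrtE t : 0 < t -> Num.sqrt (g t) * Num.sqrt (g t) = g t.
  by move=> /g0 h; rewrite -expr2 sqr_sqrtr // ltW.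
(* every identity between functions of C reduces to a scalar one *)
have calc h h' c c' : is_fcalc h C c -> is_fcalc h' C c' ->
    (forall t, 0 < t -> h t = h' t) -> forall v, c v = c' v.
  move=> hc hc' hh' v; rewrite (fcalc_unique nontrivial bC sC hc hc') //.
  by move=> t /(posop_spectrum_gt0 nontrivial); exact: hh'.
have M1 := is_fcalcM nontrivial bC sC.
have one h c : is_fcalc h C c -> (forall t, 0 < t -> h t = 1) -> forall v, c v = v.
  by move=> hc h1 v; rewrite (calc _ _ _ _ hc (is_fcalc_cst bC 1) h1) scale1r.
have bb'v v : b (b' v) = v.
  by apply: (one _ _ (M1 _ _ _ _ bP b'P)) => t t0 /=; rewrite mulfV // isqrt.
have bxy := psqrt_bounded nontrivial y; have biy := pisqrt_bounded nontrivial y.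
pose X v := psqrt y (b (b (psqrt y v))).
have posX : posdef X.
  have bX : bounded_op X.
    exact: (bounded_op_comp bxy (bounded_op_comp bb (bounded_op_comp bb bxy))).
  have b'b v : b' (b v) = v.
    by apply: (one _ _ (M1 _ _ _ _ b'P bP)) => t t0 /=; rewrite mulVf // isqrt.
  have sy := psqrt_sym nontrivial y.
  have /bounded_opE[_ [M M0 hM]] := bounded_op_comp biy bb'.
  have c0 : 0 < (M ^+ 2)^-1 by rewrite invr_gt0 exprn_gt0.
  apply: (coercive_posdef bX _ c0).
    by move=> v w; rewrite /X sy sb sb sy.
  move=> v; rewrite /X sy sb ripvv ler_pdivrMl ?exprn_gt0 // -exprMn.
  rewrite lerXn2r ?nnegrE ?mulr_ge0 ?nr_ge0 ?(ltW M0) //.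
  by have := hM (b (psqrt y v)); rewrite /= b'b pisqrtV.
pose x := PosOp posX; exists x.
have bsx := psqrt_bounded nontrivial x; have bix := pisqrt_bounded nontrivial x.
pose U := pisqrt x \o psqrt y \o b; pose V := b \o psqrt y \o pisqrt x.
have bU : bounded_op U by exact: (bounded_op_comp (bounded_op_comp bix bxy) bb).
have bV : bounded_op V by exact: (bounded_op_comp (bounded_op_comp bb bxy) bix).
have UV v : U (V v) = v.
  by rewrite /U /V /= -[psqrt y (b _)]/(x (pisqrt x v)) -(psqrtK nontrivial x) psqrtV // pisqrtV.
have VU v : V (U v) = v.
  rewrite /U /V /= (pisqrtK nontrivial x).
  have -> : psqrt y (b v) = x (pisqrt y (b' v)) by rewrite /= /X psqrtV // bb'v.
  by rewrite pinvK // psqrtV // bb'v.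
pose D1 := fcalc (GRing.inv \o g) C; pose D2 := fcalc (id \* (GRing.inv \o g)) C.
have D1P : is_fcalc _ C D1 := fcalcP nontrivial C civ.
have D2P : is_fcalc _ C D2 := fcalcP nontrivial C cdv.
have A1E v : whiten nontrivial x y v = U (D1 (V v)).
  have bDb w : b (D1 (b w)) = w.
    apply: (one _ _ (M1 _ _ _ _ bP (M1 _ _ _ _ D1P bP))) => t t0 /=.
    by rewrite mulrCA sqrtE // mulVf // gt_eqF // g0.
  by rewrite /U /V /= bDb psqrtK.
have A2E v : whiten nontrivial x z v = U (D2 (V v)).
  have bDb w : b (D2 (b w)) = C w.
    apply: (calc _ _ _ _ (M1 _ _ _ _ bP (M1 _ _ _ _ D2P bP)) (is_fcalc_id bC)) => t t0 /=.
    by rewrite mulrCA sqrtE // -mulrA mulVf ?mulr1 // gt_eqF // g0.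
  by rewrite /U /V /= bDb -(whitenK nontrivial y z).
have gi0 t : 0 < t -> 0 < (GRing.inv \o g) t by move=> t0; rewrite /= invr_gt0 g0.
have gd0 t : 0 < t -> 0 < (id \* (GRing.inv \o g)) t.
  by move=> t0; rewrite /= mulr_gt0 // invr_gt0 g0.
have E1 := fcalc_similar cf civ gi0 bU bV UV VU A1E.
have E2 := fcalc_similar (@ln_continuous_pos R) cdv gd0 bU bV UV VU A2E.
have P1 := fcalcP nontrivial C (continuous_pos_comp cf civ gi0).
have P2 := fcalcP nontrivial C (continuous_pos_comp (@ln_continuous_pos R) cdv gd0).
have Z := is_fcalcD bC (is_fcalcZ nontrivial bC sC lam P1) P2.
have lU := bounded_lin bU; have lsx := bounded_lin bsx.
apply/funext => v.
rewrite -[LHS]/(lam%:C *: psqrt x (fcalc f (whiten nontrivial x y) (psqrt x v)) +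
  psqrt x (fcalc (@ln R) (whiten nontrivial x z) (psqrt x v))).
rewrite E1 E2 -(opZ lsx) -(opD lsx) -(opZ lU) -(opD lU).
have -> : lam%:C *: fcalc (f \o (GRing.inv \o g)) C (V (psqrt x v)) +
    fcalc (@ln R \o (id \* (GRing.inv \o g))) C (V (psqrt x v)) = 0.
  have := calc _ _ _ _ Z (is_fcalc_cst bC 0) _ (V (psqrt x v)).
  by rewrite scale0r; apply=> t t0 /=; exact: eqg.
by rewrite !op0.
Qed.

End Solution.
End ResolventExistence.

(** * The deterministic recursion *)

Section Recursion.
Variable R : realType.
Implicit Types (u X : nat -> R) (l kap x : R) (j n k i : nat).

(** Within a dyadic block the recursion either has restarted from [l] or has
    accumulated all the increments; the drift [-kap] costs at least
    [kap / 2^(j+1)] per step. *)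
Lemma recursion_in_block u X l kap j : 0 <= kap -> (forall k, 0 <= X k) ->
  (forall k, u k.+1 <= Num.max l (u k + (X k.+1 - kap) / k.+2%:R)) ->
  forall i, (i <= 2 ^ j)%N ->
  u ((2 ^ j).-1 + i)%N <=
    Num.max (l + (\sum_(m < i) X (2 ^ j + m)%N) / 2 ^+ j)
      (u (2 ^ j).-1 + (\sum_(m < i) X (2 ^ j + m)%N) / 2 ^+ j - i%:R * (kap / 2 ^+ j.+1)).
Proof.
move=> kap0 X0 hu; set N := (2 ^ j)%N.
have N0 : (0 < N)%N by rewrite expn_gt0.
have NE : N%:R = 2 ^+ j :> R by rewrite natrX.
have Np : 0 < 2 ^+ j :> R by rewrite exprn_gt0.
elim=> [|i IH] iN.
  by rewrite addn0 big_ord0 !mul0r !addr0 subr0 le_max lexx orbT.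
have := IH (ltnW iN).
rewrite big_ord_recr /= mulrDl; set A := (\sum_(_ < _) _) / _.
set x := X (N + i)%N; have x0 : 0 <= x by exact: X0.
have A0 : 0 <= A by rewrite divr_ge0 ?(ltW Np) // sumr_ge0.
move=> hi; rewrite addnS; apply: le_trans (hu _) _.
have D0 : 0 < (N.-1 + i).+2%:R :> R by rewrite ltr0n.
have h1 : x / (N.-1 + i).+2%:R <= x / 2 ^+ j.
  by rewrite ler_wpM2l // lef_pV2 ?posrE // -NE ler_nat; lia.
have h2 : kap / 2 ^+ j.+1 <= kap / (N.-1 + i).+2%:R.
  rewrite ler_wpM2l // lef_pV2 ?posrE ?exprn_gt0 //.
  by rewrite exprS -NE -natrM ler_nat; lia.
have h3 : 0 <= x / 2 ^+ j by rewrite divr_ge0 // ltW.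
have h4 : 0 <= kap / 2 ^+ j.+1 by rewrite divr_ge0 // exprn_ge0.
have -> : X (N.-1 + i).+1 = x by congr X; lia.
rewrite mulrBl.
have -> : i.+1%:R = i%:R + 1 :> R by rewrite natr1.
move: A0 hi h1 h2 h3 h4.
move: (kap / 2 ^+ j.+1) (x / 2 ^+ j) (x / (N.-1 + i).+2%:R) (kap / (N.-1 + i).+2%:R) => q x1 x2 q' A0 hi h1 h2 h3 h4.
rewrite ge_max; apply/andP; split; first by rewrite le_max; apply/orP; left; lra.
move: hi; rewrite le_max => /orP[hi|hi]; rewrite le_max; apply/orP; [left|right].
  by lra.
lra.
Qed.

(** A block sum of at most [2^j kap / 2] is compensated by the drift of that
    block, so the value at the start of a block, once above [l + kap / 2], no
    longer increases from block to block; inside a block it exceeds that value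
    by at most [kap / 2]. *)
Lemma recursion_bounded u X l kap : 0 < kap -> (forall k, 0 <= X k) ->
  (forall k, u k.+1 <= Num.max l (u k + (X k.+1 - kap) / k.+2%:R)) ->
  (exists J, forall j, (J <= j)%N -> \sum_(i < 2 ^ j) X (2 ^ j + i)%N <= 2 ^+ j * (kap / 2)) ->
  exists M, forall n, u n <= M.
Proof.
move=> kap0 X0 hu [J hJ].
pose K := Num.max (l + kap / 2) (u (2 ^ J).-1).
have S_le j i : (J <= j)%N -> (i <= 2 ^ j)%N ->
    (\sum_(m < i) X (2 ^ j + m)%N) / 2 ^+ j <= kap / 2.
  move=> Jj ij; rewrite ler_pdivrMr ?exprn_gt0 // mulrC; apply: le_trans (hJ j Jj).
  rewrite (big_ord_widen _ (fun m => X (2 ^ j + m)%N) ij).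
  by rewrite big_mkcond ler_sum // => m _; case: ifP.
have start j : (J <= j)%N -> u (2 ^ j).-1 <= K.
  elim: j => [|j IH]; first by rewrite leqn0 => /eqP J0; rewrite /K J0 le_max lexx orbT.
  rewrite leq_eqVlt => /predU1P[<-|Jj]; first by rewrite /K le_max lexx orbT.
  have := recursion_in_block (ltW kap0) X0 hu (leqnn (2 ^ j)).
  have -> : ((2 ^ j).-1 + 2 ^ j)%N = (2 ^ j.+1).-1.
    by have : (0 < 2 ^ j)%N; rewrite ?expn_gt0 // expnS; lia.
  have hS := S_le j _ Jj (leqnn _); have {}IH := IH Jj.
  move=> /le_trans; apply; rewrite ge_max; apply/andP; split.
    by rewrite /K le_max; apply/orP; left; lra.
  apply: le_trans IH.
  have -> : (2 ^ j)%:R * (kap / 2 ^+ j.+1) = kap / 2.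
    by rewrite natrX exprS; field; rewrite gt_eqF // exprn_gt0.
  lra.
have late n : (2 ^ J <= n.+1)%N -> u n <= K + kap / 2.
  move=> Jn; pose j := trunc_log 2 n.+1.
  have /andP[j1 j2] := trunc_log_bounds (isT : 1 < 2)%N (isT : 0 < n.+1)%N.
  rewrite -/j in j1 j2.
  have Jj : (J <= j)%N by rewrite -ltnS -(ltn_exp2l _ _ (isT : 1 < 2)%N) (leq_ltn_trans Jn).
  have e : ((2 ^ j).-1 + (n - (2 ^ j).-1))%N = n.
    by rewrite subnKC // -ltnS prednK ?expn_gt0.
  have ij : (n - (2 ^ j).-1 <= 2 ^ j)%N.
    by move: j2; rewrite expnS; lia.
  have := recursion_in_block (ltW kap0) X0 hu ij; rewrite e.
  have hS := S_le j _ Jj ij; have hs := start j Jj.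
  have h4 : 0 <= (n - (2 ^ j).-1)%:R * (kap / 2 ^+ j.+1).
    by rewrite mulr_ge0 // divr_ge0 ?exprn_ge0 // ltW.
  have hK : l + kap / 2 <= K by rewrite /K le_max lexx.
  move=> /le_trans; apply; rewrite ge_max; apply/andP; split; lra.
exists (`|K| + kap / 2 + \sum_(m < 2 ^ J) `|u m|) => n.
have s0 : 0 <= \sum_(m < 2 ^ J) `|u m| by rewrite sumr_ge0.
have [h|h] := leqP (2 ^ J) n.+1.
  by rewrite (le_trans (late n h)) // ler_wpDr // lerD2r ler_norm.
have nJ : (n < 2 ^ J)%N by rewrite (leq_trans _ h) // ltnS leqnSn.
rewrite (bigD1 (Ordinal nJ)) //= (le_trans (ler_norm _)) //.
set S := \sum_(_ < _ | _) _; have S0 : 0 <= S by rewrite sumr_ge0.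
have := normr_ge0 K; move: kap0 S0; lra.
Qed.

(** Summing the truncated second moment and the tail mass over the dyadic
    scales costs only a constant times the first moment. *)
Lemma dyadic_sum_le x n : 0 <= x ->
  \sum_(j < n) Num.min (x ^+ 2 / 2 ^+ j) (2 ^+ j) <= 4 * x.
Proof.
move=> x0.
(* below the scale of x the terms 2^j add up to at most 2^n; beyond it, the
   remaining geometric tail is 2 x^2 / 2^n *)
suff : (2 ^+ n <= x -> \sum_(j < n) Num.min (x ^+ 2 / 2 ^+ j) (2 ^+ j) <= 2 ^+ n) /\
    (x < 2 ^+ n -> \sum_(j < n) Num.min (x ^+ 2 / 2 ^+ j) (2 ^+ j) <= 4 * x - 2 * x ^+ 2 / 2 ^+ n).
  case: (leP (2 ^+ n) x) => h [h1 h2].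
    by apply: le_trans (h1 isT) _; move: h; lra.
  apply: le_trans (h2 isT) _; rewrite gerBl divr_ge0 ?exprn_ge0 //.
  by rewrite mulr_ge0 // sqr_ge0.
elim: n => [|n [IH1 IH2]].
  rewrite big_ord0 expr0 divr1; split=> [_|x1]; first exact: ler01.
  nra.
rewrite big_ord_recr /= exprS; set q : R := 2 ^+ n.
have q0 : 0 < q by rewrite exprn_gt0.
have m1 : Num.min (x ^+ 2 / q) q <= x ^+ 2 / q by rewrite ge_min lexx.
have m2 : Num.min (x ^+ 2 / q) q <= q by rewrite ge_min lexx orbT.
have qx : 2 * x ^+ 2 / (2 * q) = x ^+ 2 / q by field; rewrite gt_eqF.
split=> [h|h].
  have := IH1 (le_trans (_ : q <= 2 * q) h); rewrite -/q => {}IH1.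
  have : q <= 2 * q by lra.
  by move=> /IH1; lra.
rewrite qx; case: (leP q x) => hq; last first.
  have := IH2 hq; rewrite -/q -mulrA; move: m1; lra.
have := IH1 hq; rewrite -/q => h1.
have hr : 2 * q <= 4 * x - x ^+ 2 / q.
  rewrite -(ler_pM2r q0) mulrBl mulfVK ?gt_eqF //; nra.
lra.
Qed.

End Recursion.

(** * Block sums of independent variables *)

Section BlockSums.
Variables (R : realType) (d d' : measure_display).
Variables (Om : measurableType d) (T : measurableType d').
Variables (P : probability Om R) (mu : probability T R).
Variable Y : nat -> {RV P >-> T}.
Hypothesis Yiid : iid_with_law P Y mu.
Local Open Scope ereal_scope.

Lemma iid_integral (g : T -> \bar R) k : measurable_fun [set: T] g ->
  (forall t, 0 <= g t) -> \int[P]_w g (Y k w) = \int[mu]_t g t.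
Proof.
move=> mg g0; rewrite -(ge0_integral_distribution (Y k) mg g0).
by apply: eq_measure_integral => A mA _; exact: (Yiid.2).
Qed.

Lemma iid_pair i j (A B : set T) : i != j -> measurable A -> measurable B ->
  P (Y i @^-1` A `&` Y j @^-1` B) = mu A * mu B.
Proof.
move=> ij mA mB.
have /(_ [fset i; j]%fset (fun k => if k == i then A else B)) := Yiid.1.
rewrite bigcap_fsetU1 bigcap_fset big_seq_fset1 big_fsetU1 /=; last first.
  by rewrite inE.
rewrite big_seq_fset1 eqxx eq_sym (negbTE ij) => -> ; last by move=> k; case: ifP.
have law k C : measurable C -> P (Y k @^-1` C) = mu C by exact: (Yiid.2 k C).
by rewrite !law.
Qed.

(** The joint law of two of the variables is a product measure, hence the
    product formula, by Tonelli. *)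
Lemma iid_integral_mul (g : T -> R) i j : i != j -> measurable_fun [set: T] g ->
  (forall t, (0 <= g t)%R) ->
  \int[P]_w (g (Y i w) * g (Y j w))%:E =
  (\int[mu]_t (g t)%:E) * (\int[mu]_t (g t)%:E).
Proof.
move=> ij mg g0.
pose Z w := (Y i w, Y j w).
have mZ : measurable_fun [set: Om] Z by exact: measurable_fun_pair.
pose Zm : {mfun Om >-> (T * T)%type} := mfun_Sub (mem_set mZ).
pose h (z : T * T) := (g z.1 * g z.2)%:E.
have mh : measurable_fun [set: T * T] h.
  apply/measurable_EFinP; apply: measurable_funM.
    exact: (measurableT_comp mg measurable_fst).
  exact: (measurableT_comp mg measurable_snd).
have h0 z : 0 <= h z by rewrite lee_fin mulr_ge0.
have -> : \int[P]_w (g (Y i w) * g (Y j w))%:E = \int[mu \x mu]_z h z.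
  rewrite -[LHS]/(\int[P]_w (h \o Zm) w) -(ge0_integral_distribution (Zm : {RV P >-> _}) mh h0).
  apply: eq_measure_integral => A mA _; symmetry.
  apply: (product_measure_unique (m' := distribution P Zm)) => // B C mB mC.
  by rewrite -(iid_pair ij mB mC).
rewrite (fubini_tonelli1 h mh h0).
have mgE : measurable_fun [set: T] (EFin \o g) by exact/measurable_EFinP.
have -> : fubini_F mu h = fun t => (\int[mu]_u (g u)%:E) * (g t)%:E.
  apply/funext => t; rewrite /fubini_F /h /=.
  under eq_integral do rewrite EFinM.
  rewrite ge0_integralZl_EFin //; last by move=> u _; rewrite lee_fin.
  by rewrite muleC.
rewrite ge0_integralZl //; last 2 first.
- by move=> u _; rewrite lee_fin.
- by apply: integral_ge0 => u _; rewrite lee_fin.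
Qed.

Section Bounded.
Variables (g : T -> R) (N : R).
Hypotheses (mg : measurable_fun [set: T] g) (g0 : forall t, (0 <= g t)%R).
Hypothesis gN : forall t, (g t <= N)%R.

Let Z k : Om -> R := g \o Y k.

Let mZ k : measurable_fun [set: Om] (Z k).
Proof. exact: measurableT_comp. Qed.

Let bounded_Lfun (F : Om -> R) (M : R) : measurable_fun [set: Om] F ->
  (forall w, (`|F w| <= M)%R) -> F \in Lfun P 1.
Proof.
move=> mF FM; apply/Lfun1_integrable; apply: (@le_integrable _ _ _ P setT measurableT _ (EFin \o cst M)).
- exact/measurable_EFinP.
- by move=> w _ /=; rewrite lee_fin (le_trans (FM w)) // ler_norm.
- by apply: finite_measure_integrable_cst.
Qed.

Let bounded_Lfun2 (F : Om -> R) (M : R) : measurable_fun [set: Om] F ->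
  (forall w, (`|F w| <= M)%R) -> F \in Lfun P 2%:E.
Proof.
move=> mF FM; rewrite inE; apply/andP; split; rewrite inE /=; first exact: mF.
rewrite /finite_norm unlock poweR_lty //.
apply: (@le_lt_trans _ _ (\int[P]_w (cst (M ^+ 2)%:E w))).
  apply: ge0_le_integral => //.
  - by move=> w _; rewrite lee_fin powR_ge0.
  - apply/measurable_EFinP; apply: (measurableT_comp (measurable_powR _)).
    exact: (measurableT_comp (@normr_measurable R setT) mF).
  - move=> w _; rewrite lee_fin powR_mulrn // lerXn2r ?nnegrE //.
    exact: le_trans (FM w).
rewrite integral_cst // lte_mul_pinfty ?lee_fin ?sqr_ge0 //.
by apply: (@le_lt_trans _ _ 1); [exact: probability_le1|exact: ltry].
Qed.

Let absZ k w : (`|Z k w| <= N)%R.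
Proof. by rewrite ger0_norm ?g0 // gN. Qed.

Let Z2 k : Z k \in Lfun P 2%:E. Proof. exact: bounded_Lfun2 (@absZ k). Qed.
Let Z1 k : Z k \in Lfun P 1. Proof. exact: bounded_Lfun (@absZ k). Qed.

Let EZ k : 'E_P[Z k] = \int[mu]_t (g t)%:E.
Proof.
rewrite unlock /Z /= (@iid_integral (EFin \o g) k) //; exact/measurable_EFinP.
Qed.

Let cov0 i j : i != j -> covariance P (Z i) (Z j) = 0.
Proof.
move=> ij; rewrite covarianceE //; last exact: Lfun2_mul_Lfun1.
rewrite !EZ [X in X - _](_ : _ = (\int[mu]_t (g t)%:E) * (\int[mu]_t (g t)%:E)).
  by rewrite subee // -(EZ i) fin_numM // expectation_fin_num.
by rewrite unlock -(iid_integral_mul ij).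
Qed.

Variable o : nat.

Definition block_sum n w : R := (\sum_(i < n) g (Y (o + i)%N w))%R.

Lemma block_sumS n : block_sum n.+1 = (block_sum n \+ Z (o + n)%N)%R.
Proof. by apply/funext => w; rewrite /block_sum big_ord_recr. Qed.

Lemma measurable_block_sum n : measurable_fun [set: Om] (block_sum n).
Proof. by apply: measurable_sum => i; exact: mZ. Qed.

Let S2 n : block_sum n \in Lfun P 2%:E.
Proof.
apply: (@bounded_Lfun2 _ (n%:R * N)); first exact: measurable_block_sum.
move=> w; rewrite /block_sum (le_trans (ler_norm_sum _ _ _)) //.
apply: (@le_trans _ _ (\sum_(i < n) N)%R); first by apply: ler_sum => i _; exact: absZ.
by rewrite sumr_const card_ord mulr_natl.
Qed.

Let covS n m : (n <= m)%N -> covariance P (block_sum n) (Z (o + m)%N) = 0.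
Proof.
elim: n => [_|n IH nm].
  rewrite (_ : block_sum 0 = cst 0%R) ?covariance_cst_l //.
  by apply/funext => w; rewrite /block_sum big_ord0.
rewrite block_sumS covarianceDl // IH ?(ltnW nm) // cov0 ?adde0 //.
by rewrite eqn_add2l ltn_eqF.
Qed.

Lemma variance_block_sum n :
  'V_P[block_sum n] <= n%:R%:E * \int[mu]_t (g t ^+ 2)%:E.
Proof.
elim: n => [|n IH].
  rewrite (_ : block_sum 0 = cst 0%R) ?variance_cst ?mul0e //.
  by apply/funext => w; rewrite /block_sum big_ord0.
rewrite block_sumS varianceD // covS // mule0 adde0.
rewrite -natr1 EFinD ge0_muleDl ?mul1e ?lee_fin //.
apply: leeD => //; rewrite varianceE //.
have -> : 'E_P[Z (o + n)%N ^+ 2] = \int[mu]_t (g t ^+ 2)%:E.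
  rewrite unlock -(@iid_integral (fun t => (g t ^+ 2)%:E) (o + n)%N) //.
    by apply/measurable_EFinP; exact: measurable_funX.
  by move=> t; rewrite lee_fin sqr_ge0.
rewrite leeBlDr ?fin_numX ?expectation_fin_num // leeDl //.
by apply: expe_ge0; apply: expectation_ge0 => w; exact: g0.
Qed.

Lemma expectation_block_sum n : 'E_P[block_sum n] = n%:R%:E * \int[mu]_t (g t)%:E.
Proof.
elim: n => [|n IH].
  rewrite (_ : block_sum 0 = cst 0%R) ?expectation_cst ?mul0e //.
  by apply/funext => w; rewrite /block_sum big_ord0.
rewrite block_sumS expectationD // ?Lfun_subset12 ?fin_num_measure // IH EZ.
by rewrite -natr1 EFinD ge0_muleDl ?mul1e ?lee_fin.
Qed.

(** Chebyshev's inequality: the variables are pairwise uncorrelated, so the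
    variance of a block sum is additive. *)
Lemma block_sum_tail n (e : R) : (0 < n)%N -> (0 < e)%R ->
  \int[mu]_t (g t)%:E <= e%:E ->
  P [set w | (n%:R * (2 * e) <= block_sum n w)%R] <=
  ((n%:R * e ^+ 2)^-1)%:E * \int[mu]_t (g t ^+ 2)%:E.
Proof.
move=> n0 e0 he.
pose X : {mfun Om >-> R} := mfun_Sub (mem_set (measurable_block_sum n)).
have ne0 : (0 < n%:R * e)%R by rewrite mulr_gt0 // ltr0n.
have hE : (fine 'E_P[X] <= n%:R * e)%R.
  have fE : 'E_P[block_sum n] \is a fin_num.
    by rewrite expectation_fin_num // Lfun_subset12 ?fin_num_measure.
  rewrite -lee_fin fineK //= expectation_block_sum EFinM lee_wpmul2l //.
apply: (@le_trans _ _ (P [set w | (n%:R * e <= `|X w - fine 'E_P[X]|)%R])).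
  apply: le_measure; rewrite ?inE.
  - rewrite -[X in measurable X]setTI.
    exact: (measurable_fun_le measurableT (measurable_cst _) (measurable_block_sum n)).
  - rewrite -[X in measurable X]setTI; apply: (measurable_fun_le measurableT) => //.
    by apply: measurableT_comp => //; exact: measurable_funB.
  - move=> w /= h; apply: le_trans (ler_norm _); move: h hE => /=; lra.
apply: le_trans (chebyshev (X : {RV P >-> R}) ne0) _.
have -> : ((n%:R * e ^+ 2)^-1 = (n%:R * e) ^- 2 * n%:R)%R.
  by rewrite exprMn; field; rewrite !gt_eqF // ltr0n.
rewrite EFinM -muleA lee_wpmul2l //; last exact: variance_block_sum.
by rewrite lee_fin invr_ge0 exprn_ge0 // ltW.
Qed.

End Bounded.

Section DyadicBlocks.
Variables (phi : T -> R) (e : R).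
Hypotheses (mphi : measurable_fun [set: T] phi) (phi0 : forall t, (0 <= phi t)%R).
Hypotheses (e0 : (0 < e)%R) (phie : \int[mu]_t (phi t)%:E <= e%:E).

(** Both the tail mass of [phi] at level [2^j] and the second moment of its
    truncation are controlled by this one function. *)
Let psi j t : R := Num.min (phi t ^+ 2 / 2 ^+ j)%R (2 ^+ j)%R.

Let psi0 j t : (0 <= psi j t)%R.
Proof. by rewrite le_min exprn_ge0 // divr_ge0 ?exprn_ge0. Qed.

Let mpsi j : measurable_fun [set: T] (psi j).
Proof.
apply: measurable_minr => //.
by apply: measurable_funM => //; exact: measurable_funX.
Qed.

Let large j := [set t | (2 ^+ j < phi t)%R].
Let mlarge j : measurable (large j).
Proof.
rewrite (_ : large j = ~` [set t | (phi t <= 2 ^+ j)%R]); last first.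
  by apply/seteqP; split=> t; rewrite /large /= ltNge => /negP.
apply: measurableC; rewrite -[X in measurable X]setTI.
exact: (measurable_fun_le measurableT mphi (measurable_cst _)).
Qed.

Let tail_le j : (2 ^+ j)%:E * mu (large j) <= \int[mu]_t (psi j t)%:E.
Proof.
have pj : (0 < 2 ^+ j :> R)%R by rewrite exprn_gt0.
rewrite -integral_cst //.
apply: (@le_trans _ _ (\int[mu]_(t in large j) (psi j t)%:E)).
  apply: ge0_le_integral => //.
  - by move=> t _; rewrite lee_fin ltW.
  - by apply/measurable_EFinP; exact: measurable_funTS.
  - move=> t /= h; rewrite lee_fin le_min lexx andbT ler_pdivlMr //.
    by rewrite -expr2 lerXn2r ?nnegrE ?(ltW pj) // ltW.
apply: ge0_subset_integral => //; first exact/measurable_EFinP.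
by move=> t _; rewrite lee_fin.
Qed.

Let F j := [set w | (2 ^+ j * (2 * e) < block_sum phi (2 ^ j) (2 ^ j) w)%R].

Let mF j : measurable (F j).
Proof.
rewrite (_ : F j = ~` [set w | (block_sum phi (2 ^ j) (2 ^ j) w <= 2 ^+ j * (2 * e))%R]).
  apply: measurableC; rewrite -[X in measurable X]setTI.
  exact: (measurable_fun_le measurableT (measurable_block_sum mphi _ _) (measurable_cst _)).
by apply/seteqP; split=> t; rewrite /F /= ltNge => /negP.
Qed.

(** A block sum is large only if one of its terms exceeds the truncation
    level [2^j], or if the sum of the truncated terms deviates from its mean. *)
Let PF_le j : P (F j) <= (1 + e ^- 2)%:E * \int[mu]_t (psi j t)%:E.
Proof.
have pj : (0 < 2 ^+ j :> R)%R by rewrite exprn_gt0.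
have nj : (0 < 2 ^ j)%N by rewrite expn_gt0.
have NE : ((2 ^ j)%N%:R = 2 ^+ j :> R)%R by rewrite natrX.
pose g t : R := Num.min (phi t) (2 ^+ j)%R.
have mg : measurable_fun [set: T] g by exact: measurable_minr.
have g0 t : (0 <= g t)%R by rewrite le_min phi0 ltW.
have gN t : (g t <= 2 ^+ j)%R by rewrite ge_min lexx orbT.
have ge' : \int[mu]_t (g t)%:E <= e%:E.
  apply: le_trans phie; apply: ge0_le_integral => //.
  - by move=> t _; rewrite lee_fin.
  - exact/measurable_EFinP.
  - exact/measurable_EFinP.
  - by move=> t _; rewrite lee_fin ge_min lexx.
have hg2 : \int[mu]_t (g t ^+ 2)%:E = (2 ^+ j)%:E * \int[mu]_t (psi j t)%:E.
  rewrite -ge0_integralZl_EFin ?(ltW pj) //; last 2 first.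
  - by move=> t _; rewrite lee_fin.
  - exact/measurable_EFinP.
  apply: eq_integral => t _; rewrite -EFinM; congr EFin; rewrite /psi /g.
  have pt := phi0 t; case: (leP (phi t) (2 ^+ j)%R) => h.
    rewrite min_l; first by field; rewrite gt_eqF.
    by rewrite ler_pdivrMr // -expr2 lerXn2r ?nnegrE ?(ltW pj).
  rewrite min_r; first by rewrite expr2.
  by rewrite ler_pdivlMr // -expr2 lerXn2r ?nnegrE ?(ltW pj) // ltW.
pose A (i : nat) := Y (2 ^ j + i)%N @^-1` large j.
have mA i : measurable (A i).
  by rewrite /A -[X in measurable X]setTI; exact: (measurable_funPT (Y _)).
pose B := [set w | ((2 ^ j)%N%:R * (2 * e) <= block_sum g (2 ^ j) (2 ^ j) w)%R].
have mB : measurable B.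
  rewrite -[X in measurable X]setTI.
  exact: (measurable_fun_le measurableT (measurable_cst _) (measurable_block_sum mg _ _)).
have FAB : F j `<=` \big[setU/set0]_(i < 2 ^ j) A i `|` B.
  move=> w /= hw; have [hA|hA] := pselect (exists2 i, (i < 2 ^ j)%N & A i w).
    by left; case: hA => i ij Ai; rewrite -bigcup_mkord; exists i.
  right; rewrite /B /= NE (le_trans (ltW hw)) // /block_sum ler_sum // => i _.
  rewrite le_min lexx leNgt; apply/negP => h; apply: hA; exists i => //.
have mU : measurable (\big[setU/set0]_(i < 2 ^ j) A i) by exact: bigsetU_measurable.
apply: (le_trans (le_measure _ _ _ FAB)); rewrite ?inE //; first exact: measurableU.
apply: le_trans (measureU2 _ mU mB) _.
rewrite EFinD ge0_muleDl ?lee_fin ?invr_ge0 ?exprn_ge0 ?(ltW e0) // mul1e.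
apply: leeD.
  apply: le_trans (Boole_inequality _ _) _ => //.
  apply: le_trans (tail_le j).
  have PA i : P (A i) = mu (large j) by exact: (Yiid.2 _ _ (mlarge j)).
  rewrite (eq_bigr (fun=> mu (large j))); last by move=> i _; exact: PA.
  by rewrite sumr_const card_ord -NE mule_natl.
apply: le_trans (block_sum_tail mg g0 gN (2 ^ j) nj e0 ge') _.
rewrite hg2 muleA -EFinM NE.
have -> : ((2 ^+ j * e ^+ 2)^-1 * 2 ^+ j = e ^- 2)%R.
  by field; rewrite !gt_eqF.
by [].
Qed.

(** Borel-Cantelli: by [dyadic_sum_le] the bounds of [PF_le] add up to a
    multiple of the first moment of [phi]. *)
Lemma block_sums_eventually_small :
  {ae P, forall w, exists J, forall j, (J <= j)%N ->
    (\sum_(i < 2 ^ j) phi (Y (2 ^ j + i)%N w) <= 2 ^+ j * (2 * e))%R}.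
Proof.
have C0 : (0 <= 1 + e ^- 2)%R by rewrite addr_ge0 // invr_ge0 exprn_ge0 // ltW.
have sumF : \sum_(j <oo) P (F j) < +oo.
  apply: (@le_lt_trans _ _ ((1 + e ^- 2)%:E * (4 * e)%:E)); last exact: ltry.
  apply: lime_le; first exact: is_cvg_nneseries.
  apply: nearW => n.
  apply: (@le_trans _ _ (\sum_(0 <= j < n) (1 + e ^- 2)%:E * \int[mu]_t (psi j t)%:E)).
    exact: lee_sum.
  rewrite -ge0_sume_distrr; last first.
    by move=> j _; apply: integral_ge0 => t _; rewrite lee_fin.
  apply: lee_wpmul2l; first by rewrite lee_fin.
  rewrite -ge0_integral_sum //; last 2 first.
  - by move=> j; exact/measurable_EFinP.
  - by move=> j t _; rewrite lee_fin.
  apply: (@le_trans _ _ (\int[mu]_t (4%:E * (phi t)%:E))).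
    apply: ge0_le_integral => //.
    - by move=> t _; apply: sume_ge0 => j _; rewrite lee_fin.
    - by apply: emeasurable_sum => j; exact/measurable_EFinP.
    - by apply: measurable_funeM; exact/measurable_EFinP.
    - move=> t _; rewrite sumEFin -EFinM lee_fin big_mkord.
      exact: dyadic_sum_le.
  rewrite ge0_integralZl_EFin //; last 2 first.
  - by move=> t _; rewrite lee_fin.
  - exact/measurable_EFinP.
  by rewrite EFinM lee_wpmul2l.
have := lim_sup_set_cvg0 mF sumF => h0.
exists (lim_sup_set F); split => //.
  by apply: bigcap_measurable => // n _; apply: bigcup_measurable.
move=> w /= hw n _; apply: contrapT => hn; apply: hw; exists n => j nj.
rewrite leNgt; apply/negP => hj; apply: hn; exists j => //.
Qed.

End DyadicBlocks.

End BlockSums.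

(** * The stochastic recursion *)

Section StochasticRecursion.
Variables (R : realType) (d d' : measure_display).
Variables (Om : measurableType d) (T : measurableType d').
Variables (P : probability Om R) (mu : probability T R).
Variable Y : nat -> {RV P >-> T}.
Hypothesis Yiid : iid_with_law P Y mu.
Variables (F : R -> R) (a : T -> R) (s0 kap : R).
Hypotheses (ndF : {homo F : s t / s <= t}) (kap0 : 0 < kap) (Fs0 : F s0 <= - kap).
Hypothesis ma : measurable_fun [set: T] a.
Hypothesis Fint : (\int[mu]_y (Num.max (F (a y)) 0)%:E < +oo)%E.

Let mF : measurable_fun [set: R] F.
Proof. exact: nondecreasing_measurable. Qed.

Let phi (n : nat) y := Num.max (F (a y - n%:R) + kap) 0.

Let mphi n : measurable_fun [set: T] (phi n).
Proof.
apply: measurable_maxr => //; apply: measurable_funD => //.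
by apply: (measurableT_comp mF); exact: measurable_funB.
Qed.

Let phi0 n y : 0 <= phi n y.
Proof. by rewrite le_max lexx orbT. Qed.

(** Dominated convergence: [F (a y - n)] is eventually below [-kap], so [phi n]
    vanishes in the limit. *)
Let phi_small (e : R) : 0 < e -> exists n, (\int[mu]_y (phi n y)%:E <= e%:E)%E.
Proof.
move=> e0.
pose g y := Num.max (F (a y)) 0 + kap.
have mmax : measurable_fun [set: T] (fun y => Num.max (F (a y)) 0).
  by apply: measurable_maxr => //; exact: (measurableT_comp mF ma).
have g0 y : 0 <= g y by rewrite addr_ge0 ?(ltW kap0) // le_max lexx orbT.
have ig : mu.-integrable setT (EFin \o g).
  apply/integrableP; split.
    by apply/measurable_EFinP; apply: measurable_funD.
  under eq_integral => y _ do rewrite /= ger0_norm // /g EFinD.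
  rewrite ge0_integralD //; last 3 first.
  - by move=> y _; rewrite lee_fin le_max lexx orbT.
  - exact/measurable_EFinP.
  - by move=> y _; rewrite lee_fin ltW.
  rewrite lte_add_pinfty // integral_cst // lte_mul_pinfty ?lee_fin ?(ltW kap0) //.
  by apply: (@le_lt_trans _ _ 1%E); [exact: probability_le1|exact: ltry].
have phig n y : phi n y <= g y.
  rewrite ge_max g0 andbT lerD2r le_max; apply/orP; left.
  by apply: ndF; rewrite gerBl.
have phicvg y : (phi n y)%:E @[n --> \oo] --> 0%E.
  have [N hN] : exists N : nat, a y - N%:R <= s0.
    exists (Num.truncn `|a y - s0|).+1.
    have := truncnS_gt `|a y - s0|; have := ler_norm (a y - s0); lra.
  apply: cvg_near_cst; exists N => // n /= Nn.
  rewrite /phi max_r //.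
  have : F (a y - n%:R) <= F s0.
    apply: ndF; apply: le_trans hN; rewrite lerB // ler_nat //.
  by move: Fs0; lra.
have phib y n : setT y -> (`|(phi n y)%:E| <= (EFin \o g) y)%E.
  by move=> _; rewrite /= lee_fin ger0_norm.
have [_ _] := dominated_convergence measurableT
  (fun n => proj2 (measurable_EFinP _ _) (mphi n)) (measurable_cst 0%E)
  (aeW _ (fun y _ => phicvg y)) ig (aeW _ phib).
rewrite integral0 => cv; apply: contrapT => hn.
have : (e%:E <= 0)%E.
  rewrite -(cvg_lim _ cv) //; apply: lime_ge; first by apply/cvg_ex; exists 0%E.
  by apply: nearW => n; rewrite leNgt; apply/negP => h; apply: hn; exists n; exact: ltW.
by rewrite lee_fin leNgt e0.
Qed.

(** As long as [u] stays above a high level [n], its increments are at most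
    [(phi n (Y k) - kap) / (k + 1)], and [phi n] has mean at most [kap / 4]; below that
    level there is nothing to prove. *)
Lemma stochastic_recursion_bounded :
  {ae P, forall w, forall u : nat -> R,
    (forall k, u k.+1 <= u k + F (a (Y k.+1 w) - u k.+1) / k.+2%:R) ->
    exists M, forall n, u n <= M}.
Proof.
have e0 : 0 < kap / 4 by rewrite divr_gt0.
have [n hn] := phi_small e0.
have := block_sums_eventually_small Yiid (mphi n) (phi0 n) e0 hn.
apply: filterS => w [J hJ] u hu.
apply: (@recursion_bounded _ u (fun k => phi n (Y k w)) n%:R kap kap0).
- by move=> k; exact: phi0.
- move=> k; rewrite le_max; case: (leP (u k.+1) n%:R) => //= un.
  apply: le_trans (hu k) _; rewrite lerD2l ler_wpM2r ?invr_ge0 //.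
  rewrite lerBrDr le_max; apply/orP; left; rewrite lerD2r.
  by apply: ndF; rewrite lerB // ltW.
- exists J => j /hJ; have -> : 2 * (kap / 4) = kap / 2 by field.
  by [].
Qed.

End StochasticRecursion.

Section MeasureAndScalarFacts.
Variables (R : realType) (H : hilbertType R).

Lemma measurable_thompson (g : posop H -> R) :
  (forall c, thompson_open [set x | c < g x]) ->
  measurable_fun [set: borel_posop H] (g : borel_posop H -> R).
Proof.
move=> og mD; apply: (measurability _ (RGenOInfty.measurableE R)) => //.
move=> _ [_ [c ->] <-]; rewrite setTI; apply: sub_sigma_algebra.
have -> : g @^-1` `]c, +oo[%classic = [set x | c < g x].
  by apply/seteqP; split=> x /=; rewrite in_itv /= andbT.
exact: og.
Qed.

(** The integral of a nonnegative function is a supremum over simple functions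
    below it, so it is monotone also when [g] is merely a function, as is
    the operator norm of [f(y)] in the application. *)
Lemma ge0_le_integral_nonmeasurable d (T : measurableType d) (mu : {measure set T -> \bar R})
    (f g : T -> \bar R) : (forall t, 0 <= f t)%E -> (forall t, f t <= g t)%E ->
  (\int[mu]_t f t <= \int[mu]_t g t)%E.
Proof.
move=> f0 fg; rewrite !ge0_integralTE //; last by move=> t; exact: le_trans (fg t).
apply: ereal_sup_le => _ [h /= hf <-]; exists h => //= t.
exact: le_trans (hf t) (fg t).
Qed.

Lemma lnplus_mul_le (s t : R) : 0 <= s -> s <= t -> s * lnplus s <= t * lnplus t.
Proof.
move=> s0 st; rewrite ler_pM //; first by rewrite le_max lexx orbT.
rewrite ge_max; apply/andP; split; last by rewrite le_max lexx orbT.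
have [->|sn0] := eqVneq s 0; first by rewrite ln0 // le_max lexx orbT.
have sp : 0 < s by rewrite lt_neqAle eq_sym sn0.
by rewrite le_max ler_ln ?posrE ?st // (lt_le_trans sp).
Qed.

Lemma le_add_mul_lnplus (s : R) : 0 <= s -> s <= expR 1 + s * lnplus s.
Proof.
move=> s0; have [h|h] := leP s (expR 1).
  by rewrite (le_trans h) // lerDl mulr_ge0 // le_max lexx orbT.
have sp : 0 < s by rewrite (lt_trans (expR_gt0 1)).
have h1 : 1 <= ln s by rewrite -(expRK 1) ler_ln ?posrE ?expR_gt0 // ltW.
apply: (@le_trans _ _ (s * lnplus s)); last by rewrite lerDr expR_ge0.
by rewrite ler_peMr // le_max h1.
Qed.

Lemma sign_change_at_1 (f : R -> R) : f 1 = 0 -> is_derive (1 : R) (1 : R) f 1 ->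
  exists h : R, [/\ 0 < h, h < 1, 0 < f (1 + h) & f (1 - h) < 0].
Proof.
move=> f1 df.
have dv : h^-1 *: ((f \o shift 1) (h *: (1 : R)) - f 1) @[h --> 0^'] --> 'D_1 f 1.
  exact: (@ex_derive _ _ _ _ _ _ _ df).
rewrite (@derive_val _ _ _ _ _ _ _ df) in dv.
have h2 : (0 : R) < 1 / 2 by rewrite divr_gt0.
move/cvgrPdist_lt : dv => /(_ _ h2) [r /= r0 hr].
pose h : R := Num.min (r / 2) (1 / 2).
have h0 : 0 < h by rewrite lt_min !divr_gt0.
have hr2 : h < r.
  by apply: le_lt_trans (_ : r / 2 < r); [rewrite ge_min lexx|lra].
have q (k : R) : k != 0 -> `|k| < r -> 0 < k^-1 * f (k + 1).
  move=> k0 kr; have := hr k; rewrite /ball /= sub0r normrN => /(_ kr k0).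
  rewrite f1 subr0 /GRing.scale /= mulr1 ltr_norml => /andP[_]; lra.
exists h; split => //.
- by apply: le_lt_trans (_ : 1 / 2 < 1); [rewrite ge_min lexx orbT|lra].
- have := q h; rewrite gt_eqF // gtr0_norm // => /(_ isT hr2).
  by rewrite pmulr_rgt0 ?invr_gt0 // addrC.
- have := q (- h); rewrite oppr_eq0 gt_eqF // normrN gtr0_norm // => /(_ isT hr2).
  by rewrite invrN mulNr oppr_gt0 pmulr_rlt0 ?invr_gt0 // addrC.
Qed.

End MeasureAndScalarFacts.

(** * Boundedness of the resolvent iteration *)

Section ThompsonBound.
Variables (R : realType) (H : hilbertType R) (f : R -> R).
Hypothesis nontrivial : exists v : H, v != 0.
Hypotheses (f_mono : operator_monotone f) (f1 : f 1 = 0).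
Hypothesis df1 : is_derive (1 : R) (1 : R) f 1.

Let cf : continuous_pos f := f_mono.1.
Let ndf s t : 0 < s -> s <= t -> f s <= f t := operator_monotone_le nontrivial f_mono.

Lemma resolventP lam (y z : posop H) : 0 < lam ->
  is_resolvent f lam y z (resolvent f lam y z).
Proof.
move=> lam0; apply: (@xgetPex _ z [set x | is_resolvent f lam y z x]).
exact: resolvent_exists.
Qed.

Variable mu : probability (borel_posop H) R.
Hypothesis mu_int : (\int[mu]_y
       (opnorm (fcalc f (y : posop H)) * lnplus (opnorm (fcalc f (y : posop H))))%:E
       < +oo)%E.

(** [s <= e + s ln^+ s], and [s ln^+ s] is increasing in [s >= 0]. *)
Lemma dominated_integral_lty (g : borel_posop H -> R) : measurable_fun setT g ->
  (forall y, `|g y| <= opnorm (fcalc f (y : posop H))) ->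
  (\int[mu]_y (Num.max (g y) 0)%:E < +oo)%E.
Proof.
move=> mg hg; pose G y := Num.max (g y) 0.
have G0 y : 0 <= G y by rewrite le_max lexx orbT.
have Gle y : G y <= opnorm (fcalc f (y : posop H)).
  rewrite ge_max; apply/andP; split; first exact: le_trans (ler_norm _) (hg y).
  exact: le_trans (normr_ge0 _) (hg y).
have mG : measurable_fun setT G by exact: measurable_maxr.
have mL : measurable_fun setT (fun y => G y * lnplus (G y)).
  apply: measurable_funM => //; apply: measurable_maxr => //.
  exact: (measurableT_comp (@measurable_ln R) mG).
have L0 y : 0 <= G y * lnplus (G y) by rewrite mulr_ge0 // le_max lexx orbT.
apply: (@le_lt_trans _ _ (\int[mu]_y ((expR 1)%:E + (G y * lnplus (G y))%:E))%E).
  apply: ge0_le_integral_nonmeasurable => y; first by rewrite lee_fin (G0 y).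
  by rewrite -EFinD lee_fin; exact/le_add_mul_lnplus/G0.
rewrite ge0_integralD //; last 2 first.
- by move=> y _; rewrite lee_fin.
- exact/measurable_EFinP.
rewrite lte_add_pinfty //.
  rewrite integral_cst // lte_mul_pinfty ?lee_fin ?expR_ge0 //.
  by apply: (@le_lt_trans _ _ 1%E); [exact: probability_le1|exact: ltry].
apply: le_lt_trans mu_int; apply: ge0_le_integral_nonmeasurable => y; first by rewrite lee_fin.
by rewrite lee_fin lnplus_mul_le.
Qed.

Lemma measurable_ln_nmax : measurable_fun setT (fun y : borel_posop H => ln (nmax (y : posop H))).
Proof.
apply: (measurableT_comp (@measurable_ln R)).
apply: (@measurable_thompson _ _ (fun x : posop H => nmax x)) => c.
exact: (@thompson_open_superlevel _ _ nontrivial (fun x : posop H => nmax x)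
  (nmax_gt0 nontrivial) (nmin_whiten_nmax nontrivial) c).
Qed.

Lemma measurable_ln_nmin : measurable_fun setT (fun y : borel_posop H => ln (nmin (y : posop H))).
Proof.
apply: (measurableT_comp (@measurable_ln R)).
apply: (@measurable_thompson _ _ (fun x : posop H => nmin x)) => c.
exact: (@thompson_open_superlevel _ _ nontrivial (fun x : posop H => nmin x)
  (nmin_gt0 nontrivial) (nmin_whiten_nmin nontrivial) c).
Qed.

Variables (d : measure_display) (Omega : measurableType d) (P : probability Omega R).
Variable Y : nat -> {RV P >-> borel_posop H}.
Hypothesis Y_iid : iid_with_law P Y mu.
Variable S1 : posop H.

Let S w := resolvent_iter f (fun k => Y k w) S1.

Let S_resolvent w k : is_resolvent f k.+2%:R^-1 (Y k.+1 w) (S w k) (S w k.+1).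
Proof. by apply: resolventP; rewrite invr_gt0 ltr0n. Qed.

(** [resolvent_nmax] is the recursion of [stochastic_recursion_bounded] for
    [u n = ln (nmax (S n))], with [F = f o exp] and [a = ln o nmax]. *)
Lemma ln_nmax_bounded : {ae P, forall w, exists M, forall n, ln (nmax (S w n)) <= M}.
Proof.
have [h [h0 h1 _ fh]] := sign_change_at_1 f1 df1.
pose F s := f (expR s); pose a (y : borel_posop H) := ln (nmax (y : posop H)).
have ndF : {homo F : s t / s <= t}.
  by move=> s t st; apply: ndf; rewrite ?expR_gt0 // ler_expR.
have Fs0 : F (ln (1 - h)) <= - - f (1 - h).
  by rewrite opprK /F lnK // posrE subr_gt0.
have mF : measurable_fun [set: R] F by exact: nondecreasing_measurable.
have Fa y : F (a y) = f (nmax (y : posop H)).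
  by rewrite /F /a lnK // posrE nmax_gt0.
have k0 : 0 < - f (1 - h) by rewrite oppr_gt0.
have Fint : (\int[mu]_y (Num.max (F (a y)) 0)%:E < +oo)%E.
  apply: dominated_integral_lty; first exact: (measurableT_comp mF measurable_ln_nmax).
  move=> y; rewrite Fa; apply: (opnorm_fcalc_ge nontrivial cf).
  exact: (approx_eig_nmax nontrivial (posop_bounded y) (@posop_sym _ _ y)).
have := stochastic_recursion_bounded Y_iid ndF k0 Fs0 measurable_ln_nmax Fint.
apply: filterS => w; apply => k.
have k2 : 0 < k.+2%:R^-1 :> R by rewrite invr_gt0 ltr0n.
have := resolvent_nmax nontrivial f_mono k2 (S_resolvent w k).
rewrite mulrC; congr (_ <= _ + _ / _).
by rewrite /F expRB !lnK // posrE nmax_gt0.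
Qed.

(** The same for [u n = - ln (nmin (S n))], with [F s = - f (exp (- s))]. *)
Lemma ln_nmin_bounded : {ae P, forall w, exists M, forall n, - ln (nmin (S w n)) <= M}.
Proof.
have [h [h0 h1 fh _]] := sign_change_at_1 f1 df1.
pose F s := - f (expR (- s)); pose a (y : borel_posop H) := - ln (nmin (y : posop H)).
have ndF : {homo F : s t / s <= t}.
  by move=> s t st; rewrite lerN2; apply: ndf; rewrite ?expR_gt0 // ler_expR lerN2.
have Fs0 : F (- ln (1 + h)) <= - f (1 + h).
  by rewrite /F opprK lnK // posrE addr_gt0.
have mF : measurable_fun [set: R] F by exact: nondecreasing_measurable.
have ma : measurable_fun setT a by apply: measurableT_comp => //; exact: measurable_ln_nmin.
have Fa y : F (a y) = - f (nmin (y : posop H)).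
  by rewrite /F /a opprK lnK // posrE nmin_gt0.
have Fint : (\int[mu]_y (Num.max (F (a y)) 0)%:E < +oo)%E.
  apply: dominated_integral_lty; first exact: (measurableT_comp mF ma).
  move=> y; rewrite Fa normrN; apply: (opnorm_fcalc_ge nontrivial cf).
  exact: (approx_eig_nmin nontrivial (posop_bounded y) (@posop_sym _ _ y)).
have := stochastic_recursion_bounded Y_iid ndF fh Fs0 ma Fint.
apply: filterS => w; apply => k.
have k2 : 0 < k.+2%:R^-1 :> R by rewrite invr_gt0 ltr0n.
have := resolvent_nmin nontrivial f_mono k2 (S_resolvent w k).
have -> : F (a (Y k.+1 w) - - ln (nmin (S w k.+1))) =
    - f (nmin (Y k.+1 w : posop H) / nmin (S w k.+1)).
  rewrite /F /a !opprK opprD opprK expRB.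
  by rewrite !lnK // posrE nmin_gt0.
set q := f _; set l := ln _; set l' := ln _ => hl.
have : - l' <= - l + - q / k.+2%:R by rewrite mulNr -opprD lerN2 mulrC.
exact.
Qed.

Lemma resolvent_iter_bounded : {ae P, forall w, exists M : R, forall n,
    thompson (S w n) posop1 <= M}.
Proof.
have := ln_nmin_bounded; apply: filterS2 ln_nmax_bounded => w [M1 h1] [M2 h2].
exists (`|M1| + `|M2|) => n; apply: (thompson_posop1_le nontrivial).
- by rewrite addr_ge0.
- by rewrite (le_trans (h1 n)) // (le_trans (ler_norm M1)) // lerDl.
- rewrite lerNl (le_trans (h2 n)) // (le_trans (ler_norm M2)) // lerDr //.
Qed.

End ThompsonBound.

Theorem lemma4p6 (R : realType) (H : hilbertType R) (f : R -> R)
    (f_mono : operator_monotone f) (f1 : f 1 = 0)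
    (df1 : is_derive (1 : R) (1 : R) f 1)
    (mu : probability (borel_posop H) R)
    (mu_supp : mu (supp mu) = 1%E)
    (mu_int : (\int[mu]_y
       (opnorm (fcalc f (y : posop H)) * lnplus (opnorm (fcalc f (y : posop H))))%:E
       < +oo)%E)
    (d : measure_display) (Omega : measurableType d) (P : probability Omega R)
    (Y : nat -> {RV P >-> borel_posop H}) (Y_iid : iid_with_law P Y mu)
    (S1 : posop H) :
  {ae P, forall w, exists M : R, forall n,
    thompson (resolvent_iter f (fun k => Y k w) S1 n) posop1 <= M}.
Proof.
(* nmax and nmin are meaningful only if there are unit vectors *)
have [nontrivial|trivial] := pselect (exists v : H, v != 0).
  exact: (resolvent_iter_bounded nontrivial f_mono f1 df1 mu_int Y_iid).
apply: aeW => w; exists 0 => n; apply: opnorm_le => // v.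
have z0 (u : H) : u = 0.
  by apply: contrapT => /eqP u0; apply: trivial; exists u.
by rewrite mul0r (z0 (fcalc _ _ v)) nr0.
Qed.
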